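(* Let $3\le p<q$ be relatively prime integers and let $H=\langle p,q,h_1,\dots,h_{n-2}\rangle\in KW(p,q)$ be of embedding dimension $n$, with $h_i=pq-x_ip-y_iq$, $0<x_1<\dots<x_{n-2}\le q/2$ and $p/2\ge y_1>\dots>y_{n-2}>0$. Suppose that there is $y\in\mathbb{N}$ with $(n-2)y\le p/2$ such that $y_i=(n-i-1)y$ for all $1\le i\le n-2$. Then the Betti numbers of $\Bbbk[H]$ are $$\beta_i=i\binom{n}{i+1},\qquad 1\le i\le n-1.$$
   Context: $\langle a_1,\dots,a_k\rangle$ denotes the additive submonoid of $\mathbb{N}$ (with $0$) generated by $a_1,\dots,a_k$. For relatively prime integers $3\le p<q$, $KW(p,q)$ is the class of numerical semigroups $\langle p,q,h_1,\dots,h_{n-2}\rangle$ ($n\ge 3$) with $h_i=pq-x_ip-y_iq$ for integers $0<x_1<\dots<x_{n-2}\le q/2$ and $p/2\ge y_1>\dots>y_{n-2}>0$; $n$ is the embedding dimension (number of minimal generators). Fix a field $\Bbbk$. Let $T=\Bbbk[u,v,u_1,\dots,u_{n-2}]$ be graded by $\deg u=p$, $\deg v=q$, $\deg u_i=h_i$, and let $I_H$ be the kernel of the $\Bbbk$-algebra homomorphism $T\to\Bbbk[t]$, $u\mapsto t^p$, $v\mapsto t^q$, $u_i\mapsto t^{h_i}$. The semigroup algebra is $\Bbbk[H]\simeq T/I_H$. The Betti numbers $\beta_i$ of $\Bbbk[H]$ are the ranks of the free modules in a minimal graded free resolution of $T/I_H$ over $T$: $0\to T^{\beta_{n-1}}\to\dots\to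 T^{\beta_1}\to T\to T/I_H\to 0$.
   Formalization: For n = 3 the formal theorem also assumes x_1 ≠ q/2 and y_1 ≠ p/2; in those boundary cases H is symmetric and the formula fails, e.g. H = ⟨4,5,6⟩ has Betti numbers (2,1), not (3,2). *)

(* Defs.v *)
From HB Require Import structures.
From mathcomp Require Import all_boot all_order all_algebra.
From mathcomp Require Import mpoly.

Set Implicit Arguments.
Unset Strict Implicit.
Unset Printing Implicit Defensive.

Import GRing.Theory.

Local Open Scope ring_scope.

(** * Numerical semigroups *)

(* The submonoid of nat generated by the values of [a]. *)
Definition generated n (a : 'I_n -> nat) (m : nat) : Prop :=
  exists c : 'I_n -> nat, m = (\sum_(i < n) c i * a i)%N.

(* For a submonoid [S] of nat, the elements satisfying this form the unique
   minimal generating set of [S]. *)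
Definition minimal_generator (S : nat -> Prop) (m : nat) : Prop :=
  [/\ S m, m <> 0%N &
      forall s t, S s -> S t -> m = (s + t)%N -> s = 0%N \/ t = 0%N].

Definition embedding_dimension (S : nat -> Prop) (n : nat) : Prop :=
  exists gs : seq nat,
    [/\ uniq gs, size gs = n & forall m, m \in gs <-> minimal_generator S m].

(* The sequences x, y, h are indexed by 1, ..., n - 2; their values elsewhere
   are irrelevant.  [h i = p q - x_i p - y_i q] is stated without subtraction,
   and the bounds by q / 2 and p / 2 without division. *)
Definition KW_data (p q n : nat) (x y h : nat -> nat) : Prop :=
  [/\ (3 <= n)%N,
      forall i, (1 <= i <= n - 2)%N -> (h i + x i * p + y i * q = p * q)%N,
      [/\ (0 < x 1)%N,
          forall i, (1 <= i)%N -> (i.+1 <= n - 2)%N -> (x i < x i.+1)%N &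
          (2 * x (n - 2) <= q)%N] &
      [/\ (2 * y 1 <= p)%N,
          forall i, (1 <= i)%N -> (i.+1 <= n - 2)%N -> (y i.+1 < y i)%N &
          (0 < y (n - 2))%N]].

(* The n-tuple (p, q, h_1, ..., h_{n-2}). *)
Definition KW_generators (p q n : nat) (h : nat -> nat) (i : 'I_n) : nat :=
  match nat_of_ord i with
  | 0 => p
  | 1 => q
  | j.+2 => h j.+1
  end.

(** * Graded polynomial rings and semigroup ideals *)

Section Betti.
Variables (k : fieldType) (n : nat) (a : 'I_n -> nat).

Local Notation T := {mpoly k[n]}.

(* The kernel of T -> k[t], X_i |-> t^(a_i). *)
Definition semigroup_ideal (f : T) : Prop :=
  mmap (@polyC k) (fun i => 'X^(a i)) f = 0 :> {poly k}.

(* The degree of a monomial of T for the grading deg X_i = a_i. *)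
Definition wdeg (m : 'X_{1..n}) : nat := (\sum_(i < n) m i * a i)%N.

(* A minimal graded free resolution
     ... -> T^(rk 2) -> T^(rk 1) -> T^(rk 0) = T -> T / I -> 0.
   Elements of the free modules are row vectors and [diff i] acts by right
   multiplication; [shift i j] is the degree of the j-th basis vector of
   T^(rk i).  Since resolutions are minimal and F_0 is generated in degree 0,
   natural-number shifts lose no generality when the weights [a] are positive.
   As rk 0 = 1, the vectors of T^(rk 0) with coordinates in I form I itself. *)
Record minimal_graded_resolution (I : T -> Prop) := MinimalGradedResolution {
  rk : nat -> nat;
  shift : forall i, 'I_(rk i) -> nat;
  diff : forall i, 'M[T]_(rk i.+1, rk i);
  rk0 : rk 0 = 1%N;
  shift0 : forall j, @shift 0 j = 0%N;
  exact0 : forall v : 'rV[T]_(rk 0),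
    (forall j, I (v 0 j)) <-> (exists w, v = w *m diff 0);
  exactS : forall i (v : 'rV[T]_(rk i.+1)),
    v *m diff i = 0 <-> (exists w, v = w *m diff i.+1);
  diff_graded : forall i r c m, m \in msupp (diff i r c) ->
    (wdeg m + shift c)%N = shift r;
  (* the entries of the differentials lie in the graded maximal ideal *)
  diff_minimal : forall i r c, (diff i r c)@_0%MM = 0
}.

(* [b] is the i-th Betti number of T / I over T: minimal graded free
   resolutions exist, and the i-th free module of any of them has rank [b]. *)
Definition betti_number (I : T -> Prop) (i b : nat) : Prop :=
  (exists F : minimal_graded_resolution I, rk F i = b) /\
  (forall F : minimal_graded_resolution I, rk F i = b).

End Betti.

Arguments generated {n} a m.
Arguments KW_generators p q n h i : clear implicits.
Arguments semigroup_ideal k {n} a f.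
Arguments betti_number {k n} a I i b.

(* Main.v *)
Require Import Defs.
From mathcomp Require Import all_boot all_order all_algebra.
From mathcomp Require Import mpoly.
From mathcomp Require Import zify.
From Stdlib Require Import ClassicalEpsilon.

(** Put m = n - 2 and N = p - m d, so that N > d.  Modulo u, the ideal I_H becomes the
    monomial ideal J = (u_1, ..., u_m)^2 + (u_1, ..., u_m) v^d + (v^N): every
    generator of J is congruent modulo u to a binomial of I_H, and the monomials outside
    J not divisible by u have as degrees exactly the Apery set of H at p.
    Since u is regular modulo both ideals, a minimal graded resolution of T/J lifts,
    differential by differential, to one of T/I_H with the same ranks (graded Nakayama).

    J is resolved by adjoining the variables u_i one at a time.  If J and
    P = (v^d, u_1, ..., u_{i-1}) are the ideals before the step and P' = P + (u_i), then
    the ideal after it is J' = J + u_i P', and u_i P' meets J in u_i J.  Two mapping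
    cones, of J -> P' and then of P'/J --u_i--> T/J, give a resolution of T/J'; it is
    minimal because the comparison map from the resolution of T/J to the Koszul complex
    of P has entries in the maximal ideal, a property that the step preserves.  The ranks
    satisfy a Pascal-type recursion.

    Betti numbers are well defined because a chain map between two minimal resolutions
    lifting the identity is invertible modulo the maximal ideal. *)

Set Implicit Arguments.
Unset Strict Implicit.
Unset Printing Implicit Defensive.

Import GRing.Theory.

Local Open Scope ring_scope.

(** * Supports of polynomials *)

Section Support.
Variables (k : fieldType) (n : nat).
Local Notation T := {mpoly k[n]}.
Implicit Types (f g : T) (m : 'X_{1..n}) (C : pred 'X_{1..n}).

Definition supp_in C f := forall m, m \in msupp f -> C m.

Lemma supp_inP C f : (forall m, ~~ C m -> f@_m = 0) <-> supp_in C f.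
Proof.
split=> [h m|h m]; first by rewrite mcoeff_msupp; apply: contraNT => /h/eqP.
by move=> nC; apply/eqP; rewrite mcoeff_eq0; apply: contra nC; apply: h.
Qed.

Lemma supp_in0 C : supp_in C (0 : T).
Proof. by move=> m; rewrite mcoeff_msupp mcoeff0 eqxx. Qed.

Lemma supp_in_pred0 f : supp_in xpred0 f -> f = 0.
Proof. by move/supp_inP=> h; apply/mpolyP => m; rewrite h // mcoeff0. Qed.

Lemma supp_inX C m : C m -> supp_in C ('X_[m] : T).
Proof. by move=> Cm m'; rewrite msuppX inE => /eqP->. Qed.

Lemma supp_inD C f g : supp_in C f -> supp_in C g -> supp_in C (f + g).
Proof.
move=> hf hg m; rewrite mcoeff_msupp mcoeffD => nz.
have [/hf//|] := boolP (m \in msupp f); rewrite -mcoeff_eq0 => /eqP f0.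
by apply: hg; rewrite mcoeff_msupp; move: nz; rewrite f0 add0r.
Qed.

Lemma supp_inN C f : supp_in C f -> supp_in C (- f).
Proof. by move=> hf m; rewrite mcoeff_msupp mcoeffN oppr_eq0 -mcoeff_msupp; apply: hf. Qed.

Lemma supp_in_sum C I (r : seq I) (P : pred I) (F : I -> T) :
  (forall i, P i -> supp_in C (F i)) -> supp_in C (\sum_(i <- r | P i) F i).
Proof. by move=> h; elim/big_rec: _ => [|i f /h]; [apply: supp_in0|apply: supp_inD]. Qed.

Lemma supp_inM C1 C2 C f g :
  (forall m1 m2, C1 m1 -> C2 m2 -> C (m1 + m2)%MM) ->
  supp_in C1 f -> supp_in C2 g -> supp_in C (f * g).
Proof.
by move=> h hf hg m /msuppM_le /allpairsP[[m1 m2] /= [/hf c1 /hg c2 ->]]; apply: h.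
Qed.

Lemma supp_in_sub C C' f : (forall m, C m -> C' m) -> supp_in C f -> supp_in C' f.
Proof. by move=> h hf m /hf/h. Qed.

(** Truncation: with [C] a condition on the degree it extracts homogeneous parts, with [C] a
    monomial ideal it splits off the part in that ideal. *)
Definition pfilt C f : T := \sum_(m <- msupp f | C m) f@_m *: 'X_[m].

Lemma mcoeff_pfilt C f m : (pfilt C f)@_m = if C m then f@_m else 0.
Proof.
rewrite /pfilt raddf_sum /= (eq_bigr (fun m' => if m' == m then f@_m else 0)).
  case: ifP => Cm; last first.
    by rewrite big1 // => m' Cm'; case: eqP => // e; rewrite e Cm in Cm'.
  have [mf|mf] := boolP (m \in msupp f).
    rewrite big_mkcond (bigD1_seq m) ?msupp_uniq //= Cm eqxx big1 ?addr0 //.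
    by move=> m' /negbTE->; rewrite if_same.
  by rewrite (memN_msupp_eq0 mf) big1 // => m' _; case: eqP.
move=> m' _; rewrite mcoeffZ mcoeffX; case: eqP => [->|_]; first by rewrite mulr1.
by rewrite mulr0.
Qed.

Lemma pfiltD C f g : pfilt C (f + g) = pfilt C f + pfilt C g.
Proof.
apply/mpolyP => m; rewrite mcoeffD !mcoeff_pfilt mcoeffD.
by case: ifP; rewrite ?addr0.
Qed.

Lemma pfilt0 C : pfilt C 0 = 0.
Proof. by apply/mpolyP => m; rewrite mcoeff_pfilt mcoeff0; case: ifP. Qed.

Lemma pfilt_sum C I (r : seq I) (F : I -> T) :
  pfilt C (\sum_(i <- r) F i) = \sum_(i <- r) pfilt C (F i).
Proof. by elim: r => [|i r IH]; rewrite ?big_nil ?pfilt0 // !big_cons pfiltD IH. Qed.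

Lemma pfilt_supp C f : supp_in C (pfilt C f).
Proof. by apply/supp_inP => m /negbTE nC; rewrite mcoeff_pfilt nC. Qed.

Lemma pfilt_supp_in C C' f : supp_in C' f -> supp_in C' (pfilt C f).
Proof.
by move=> /supp_inP h; apply/supp_inP => m /h f0; rewrite mcoeff_pfilt f0 if_same.
Qed.

Lemma pfilt_id C f : supp_in C f -> pfilt C f = f.
Proof.
move=> /supp_inP h; apply/mpolyP => m; rewrite mcoeff_pfilt.
by case: ifPn => // /h ->.
Qed.

Lemma pfilt_eq0 C f : supp_in (predC C) f -> pfilt C f = 0.
Proof.
move=> /supp_inP h; apply/mpolyP => m; rewrite mcoeff_pfilt mcoeff0.
by case: ifPn => // Cm; apply: h; rewrite /= negbK.
Qed.

Lemma pfilt_split C f : f = pfilt C f + pfilt (predC C) f.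
Proof.
apply/mpolyP => m; rewrite mcoeffD !mcoeff_pfilt /=.
by case: (C m); rewrite ?addr0 ?add0r.
Qed.

(** Whether a product monomial survives depends on its left factor alone, as for a degree condition
    and homogeneous [g]; so the two parts of [f] do not mix. *)
Lemma pfiltM C C' f g :
  (forall m1 m2, m2 \in msupp g -> C (m1 + m2)%MM = C' m1) ->
  pfilt C (f * g) = pfilt C' f * g.
Proof.
move=> h; rewrite {1}(pfilt_split C' f) mulrDl pfiltD.
rewrite [pfilt C (pfilt C' f * g)]pfilt_id; last first.
  apply: (supp_inM (C2 := fun m => m \in msupp g) _ (@pfilt_supp C' f)) => //.
  by move=> m1 m2 c1 /h->.
rewrite [pfilt C _]pfilt_eq0 ?addr0 //.
apply: (supp_inM (C2 := fun m => m \in msupp g) _ (@pfilt_supp _ f)) => //.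
by move=> m1 m2 /= c1 /h->.
Qed.

Lemma pfiltXM C C' (x : 'I_n) f :
  (forall m, C (U_(x) + m)%MM = C' m) -> pfilt C ('X_x * f) = 'X_x * pfilt C' f.
Proof.
move=> h; rewrite mulrC (pfiltM (C' := C')) 1?mulrC // => m1 m2.
by rewrite msuppX inE => /eqP->; rewrite addmC h.
Qed.

Lemma mcoeffXM (x : 'I_n) f m : ('X_x * f)@_(U_(x) + m)%MM = f@_m.
Proof. by rewrite mulrC mcoeffMX. Qed.

Lemma supp_inXM C (x : 'I_n) f :
  supp_in C ('X_x * f) <-> supp_in (fun m => C (U_(x) + m)%MM) f.
Proof.
split=> [h m|h].
  by rewrite mcoeff_msupp -(mcoeffXM x) -mcoeff_msupp; apply: h.
apply: (supp_inM (C1 := pred1 U_(x)%MM) _ _ h); last by apply: supp_inX; rewrite /=.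
by move=> m1 m2 /eqP->.
Qed.

Lemma supp_in_div (m0 : 'X_{1..n}) f :
  supp_in (fun m => m0 <= m)%MM f -> exists g, f = 'X_[m0] * g.
Proof.
move=> h; exists (\sum_(m <- msupp f) f@_m *: 'X_[m - m0]).
rewrite {1}[f]mpolyE mulr_sumr [LHS]big_seq [RHS]big_seq; apply: eq_bigr => m /h mx.
by rewrite -scalerAr -mpolyXD; congr (_ *: 'X_[_]); rewrite addmC submK.
Qed.

Lemma supp_in_split (C C' : pred 'X_{1..n}) (m0 : 'X_{1..n}) f :
  (forall m, C' m = (m0 <= m)%MM || C m) ->
  supp_in C' f <-> exists g1 g2, f = 'X_[m0] * g1 + g2 /\ supp_in C g2.
Proof.
move=> hC; split=> [h|[g1 [g2 [-> h]]]].
  have [|g1 e1] := @supp_in_div m0 (pfilt (predC C) f).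
    move=> m mm; move: (pfilt_supp mm) (pfilt_supp_in h mm) => /= /negbTE Cm.
    by rewrite hC Cm orbF.
  exists g1, (pfilt C f); rewrite -e1 addrC -pfilt_split; split=> //.
  exact: pfilt_supp.
apply: supp_inD; last by apply: supp_in_sub h => m; rewrite hC orbC => ->.
apply: (supp_inM (C1 := pred1 m0) (C2 := predT)) => //; last by apply: supp_inX => /=.
by move=> m1 m2 /= /eqP-> _; rewrite hC lem_addr.
Qed.

End Support.

(** * Graded minimal acyclic complexes and mapping cones *)

Section Complexes.
Variables (k : fieldType) (n : nat) (a : 'I_n -> nat).
Local Notation T := {mpoly k[n]}.

(** * Degrees and homogeneous matrices *)

Lemma wdegD (m1 m2 : 'X_{1..n}) : wdeg a (m1 + m2)%MM = (wdeg a m1 + wdeg a m2)%N.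
Proof. by rewrite /wdeg -big_split; apply: eq_bigr => i _; rewrite mnmDE mulnDl. Qed.

Lemma wdeg0 : wdeg a 0%MM = 0%N.
Proof. by rewrite /wdeg big1 // => i _; rewrite mnm0E. Qed.

Lemma wdegU (x : 'I_n) : wdeg a U_(x)%MM = a x.
Proof.
rewrite /wdeg (bigD1 x) //= mnm1E eqxx mul1n big1 ?addn0 // => i.
by rewrite mnm1E eq_sym => /negbTE->.
Qed.

Lemma wdegMn (x : 'I_n) e : wdeg a (U_(x) *+ e)%MM = (e * a x)%N.
Proof. by elim: e => [|e IH]; rewrite ?wdeg0 // mulmS wdegD wdegU IH mulSn. Qed.

(** Rows index the basis of the source and columns that of the target, of degrees [sr] and [sc];
    acting on row vectors, the matrix is a map of degree 0. *)
Definition graded r s (sr : 'I_r -> nat) (sc : 'I_s -> nat) (M : 'M[T]_(r, s)) :=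
  forall i j, supp_in (fun m => wdeg a m + sc j == sr i)%N (M i j).

(** Reduction modulo the graded maximal ideal. *)
Definition at0 r s (M : 'M[T]_(r, s)) : 'M[k]_(r, s) := map_mx (mcoeff 0%MM) M.

Definition img r s (M : 'M[T]_(r, s)) (v : 'rV[T]_s) := exists w, v = w *m M.

Definition catsh r1 r2 (s1 : 'I_r1 -> nat) (s2 : 'I_r2 -> nat) (i : 'I_(r1 + r2)) :=
  match split i with inl i => s1 i | inr i => s2 i end.

Lemma catsh_l r1 r2 (s1 : 'I_r1 -> nat) (s2 : 'I_r2 -> nat) i :
  catsh s1 s2 (lshift r2 i) = s1 i.
Proof. by rewrite /catsh (unsplitK (inl i)). Qed.

Lemma catsh_r r1 r2 (s1 : 'I_r1 -> nat) (s2 : 'I_r2 -> nat) i :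
  catsh s1 s2 (rshift r1 i) = s2 i.
Proof. by rewrite /catsh (unsplitK (inr i)). Qed.

Lemma graded_eq r s (sr sr' : 'I_r -> nat) (sc : 'I_s -> nat) M :
  sr =1 sr' -> graded sr sc M -> graded sr' sc M.
Proof. by move=> e h i j; rewrite -e; apply: h. Qed.

Lemma graded1 r (sr : 'I_r -> nat) : graded sr sr (1%:M).
Proof.
move=> i j; rewrite mxE; case: (i =P j) => [->|_]; last by rewrite mulr0n; apply: supp_in0.
by move=> m; rewrite msupp1 inE => /eqP->; rewrite wdeg0.
Qed.

Lemma graded0 r s sr sc : graded sr sc (0 : 'M_(r, s)).
Proof. by move=> i j; rewrite mxE; apply: supp_in0. Qed.

Lemma gradedN r s sr sc (M : 'M_(r, s)) : graded sr sc M -> graded sr sc (- M).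
Proof. by move=> h i j; rewrite mxE; apply: supp_inN. Qed.

Lemma gradedZ r s sr sc e (M : 'M_(r, s)) :
  graded sr sc M -> graded sr sc ((-1) ^+ e *: M).
Proof.
move=> h; rewrite -signr_odd; case: odd; last by rewrite expr0 scale1r.
by rewrite expr1 scaleN1r; apply: gradedN.
Qed.

Lemma graded_scalar r (sr sc : 'I_r -> nat) e (f : T) :
  supp_in (fun m => wdeg a m == e) f -> (forall i, sr i = e + sc i)%N ->
  graded sr sc f%:M.
Proof.
move=> hf hs i j; rewrite mxE; case: (i =P j) => [->|_]; last by rewrite mulr0n; apply: supp_in0.
by apply: supp_in_sub hf => m /eqP->; rewrite hs.
Qed.

Lemma gradedM r s t (sr : 'I_r -> nat) (ss : 'I_s -> nat) (st : 'I_t -> nat) M N :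
  graded sr ss M -> graded ss st N -> graded sr st (M *m N).
Proof.
move=> hM hN i j; rewrite mxE; apply: supp_in_sum => l _.
apply: supp_inM (hM i l) (hN l j) => m1 m2 /eqP e1 /eqP e2.
by rewrite wdegD -addnA e2 e1.
Qed.

Lemma graded_col r1 r2 s (s1 : 'I_r1 -> nat) (s2 : 'I_r2 -> nat) (sc : 'I_s -> nat) M N :
  graded s1 sc M -> graded s2 sc N -> graded (catsh s1 s2) sc (col_mx M N).
Proof.
move=> hM hN i j; rewrite -[i]splitK; case: (split i) => i' /=.
  by rewrite catsh_l col_mxEu; apply: hM.
by rewrite catsh_r col_mxEd; apply: hN.
Qed.

Lemma graded_row r s1 s2 (sr : 'I_r -> nat) (sh1 : 'I_s1 -> nat) (sh2 : 'I_s2 -> nat) M N :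
  graded sr sh1 M -> graded sr sh2 N -> graded sr (catsh sh1 sh2) (row_mx M N).
Proof.
move=> hM hN i j; rewrite -[j]splitK; case: (split j) => j' /=.
  by rewrite catsh_l row_mxEl; apply: hM.
by rewrite catsh_r row_mxEr; apply: hN.
Qed.

Lemma at0M r s t (M : 'M_(r, s)) (N : 'M_(s, t)) : at0 (M *m N) = at0 M *m at0 N.
Proof. exact: map_mxM. Qed.

Lemma at0_scalar r (f : T) : f@_0%MM = 0 -> at0 f%:M = 0 :> 'M_r.
Proof. by move=> f0; rewrite /at0 map_scalar_mx /= f0 raddf0. Qed.

Lemma at0N r s (M : 'M_(r, s)) : at0 (- M) = - at0 M.
Proof. exact: map_mxN. Qed.

Lemma at00 r s : at0 (0 : 'M_(r, s)) = 0.
Proof. exact: map_mx0. Qed.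

Lemma at0_col r1 r2 s (M : 'M_(r1, s)) (N : 'M_(r2, s)) :
  at0 (col_mx M N) = col_mx (at0 M) (at0 N).
Proof. exact: map_col_mx. Qed.

Lemma at0_row r s1 s2 (M : 'M_(r, s1)) (N : 'M_(r, s2)) :
  at0 (row_mx M N) = row_mx (at0 M) (at0 N).
Proof. exact: map_row_mx. Qed.

Definition hfilt r (P : pred nat) (sh : 'I_r -> nat) (v : 'rV[T]_r) : 'rV[T]_r :=
  \row_c pfilt (fun m => P (wdeg a m + sh c)%N) (v 0 c).

Lemma hfilt_mul r s P sr sc (M : 'M_(r, s)) v :
  graded sr sc M -> hfilt P sc (v *m M) = hfilt P sr v *m M.
Proof.
move=> hM; apply/rowP => j; rewrite !mxE pfilt_sum; apply: eq_bigr => i _.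
rewrite mxE; apply: pfiltM => m1 m2 /hM /eqP e.
by rewrite wdegD -addnA e.
Qed.

Record cpx := Cpx {
  crk : nat -> nat;
  csh : forall i, 'I_(crk i) -> nat;
  cd : forall i, 'M[T]_(crk i.+1, crk i) }.
Arguments csh : clear implicits.
Arguments cd : clear implicits.

(** Such a complex is a minimal graded free resolution of the cokernel of [cd C 0]; which module
    this is gets recorded separately, through [img (cd C 0)]. *)
Record good (C : cpx) : Prop := Good {
  good_graded : forall i, graded (csh C i.+1) (csh C i) (cd C i);
  good_min : forall i, at0 (cd C i) = 0;
  good_exact : forall i v, v *m cd C i = 0 <-> img (cd C i.+1) v }.

Lemma good_dd C : good C -> forall i, cd C i.+1 *m cd C i = 0.
Proof.
move=> gC i; apply/row_matrixP => j; rewrite row_mul row0.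
by apply/(good_exact gC); exists (delta_mx 0 j); rewrite rowE.
Qed.

(** If [C] is acyclic, this resolves the image of [cd C 0]. *)
Definition tail (C : cpx) : cpx :=
  @Cpx (fun i => crk C i.+1) (fun i => csh C i.+1) (fun i => cd C i.+1).

Lemma good_tail C : good C -> good (tail C).
Proof. by case=> h1 h2 h3; split=> i; [apply: h1|apply: h2|apply: h3]. Qed.

Definition twist e (C : cpx) : cpx :=
  @Cpx (crk C) (fun i j => (e + csh C i j)%N) (cd C).

Lemma good_twist e C : good C -> good (twist e C).
Proof.
case=> h1 h2 h3; split=> //= i j l m mM /=.
by rewrite addnCA (eqP (h1 _ _ _ _ mM)).
Qed.

Record chain_map (F G : cpx) (phi : forall i, 'M[T]_(crk F i, crk G i)) : Prop := ChainMap {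
  cm_graded : forall i, graded (csh F i) (csh G i) (phi i);
  cm_comm : forall i, cd F i *m phi i = phi i.+1 *m cd G i }.

Section Cone.
Variables (F G : cpx) (phi : forall i, 'M[T]_(crk F i, crk G i)).

Definition cone : cpx :=
  @Cpx (fun i => if i is j.+1 then (crk F j + crk G j.+1)%N else crk G 0)
    (fun i => match i with
      | 0 => csh G 0
      | j.+1 => catsh (csh F j) (csh G j.+1) end)
    (fun i => match i with
      | 0 => col_mx (phi 0) (cd G 0)
      | j.+1 => block_mx (- cd F j) (phi j.+1) 0 (cd G j.+1) end).

(** The last hypothesis makes the induced map of cokernels injective, so the cone resolves the
    quotient of the second cokernel by the first. Minimality holds because [phi] vanishes modulo the
    maximal ideal. *)
Lemma good_cone : good F -> good G -> chain_map phi -> (forall i, at0 (phi i) = 0) ->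
  (forall v, img (cd G 0) (v *m phi 0) -> img (cd F 0) v) -> good cone.
Proof.
move=> gF gG [gphi cphi] mphi inj; split.
- case=> [|i] /=; first by apply: graded_col => //; apply: good_graded.
  apply: graded_col; apply: graded_row => //; try exact: good_graded.
    by apply: gradedN; apply: good_graded.
  exact: graded0.
- case=> [|i] /=; rewrite at0_col ?at0_row ?at0N ?at00 ?mphi !good_min //.
    by rewrite col_mx0.
  by rewrite oppr0 !row_mx0 col_mx0.
(* A cycle whose first component is a boundary is a boundary: the chain-map identity moves it to a
   cycle of [G]. Exactness of [F], or [inj] in lowest degree, supplies the assumption. *)
have lift_eq i (v1 : 'rV_(crk F i)) v2 : img (cd F i) v1 ->
    v1 *m phi i + v2 *m cd G i = 0 ->
    img (block_mx (- cd F i) (phi i.+1) 0 (cd G i.+1)) (row_mx v1 v2).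
  move=> [w1 ->]; rewrite -mulmxA cphi mulmxA -mulmxDl.
  move=> /(good_exact gG) [w2 e]; exists (row_mx (- w1) w2).
  by rewrite mul_row_block mulmxN mulNmx opprK mulmx0 addr0 mulNmx -e addKr.
case=> [|i] /= v; rewrite -[v]hsubmxK; move: (lsubmx v) (rsubmx v) => v1 v2.
  rewrite mul_row_col; split=> [h|[w]].
    apply: lift_eq => //; apply: inj; exists (- v2); rewrite mulNmx.
    by apply/eqP; rewrite -addr_eq0 h.
  rewrite -[w]hsubmxK mul_row_block mulmx0 addr0 => /eq_row_mx[-> ->].
  rewrite mulmxN mulNmx mulmxDl -!mulmxA cphi (good_dd gG) mulmx0 addr0.
  by rewrite addNr.
rewrite mul_row_block mulmx0 addr0; split=> [h|[w]].
  have [e1 e2] : - (v1 *m cd F i) = 0 /\ v1 *m phi i.+1 + v2 *m cd G i.+1 = 0.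
    by move: h; rewrite mulmxN -row_mx0 => /eq_row_mx.
  by apply: lift_eq => //; apply/(good_exact gF)/oppr_inj; rewrite e1 oppr0.
rewrite -[w]hsubmxK mul_row_block mulmx0 addr0 => /eq_row_mx[-> ->].
rewrite !(mulmxN, mulNmx, opprK) mulmxDl -!mulmxA cphi.
by rewrite (good_dd gF) (good_dd gG) !mulmx0 addr0 addNr row_mx0.
Qed.

End Cone.

End Complexes.
Arguments csh {k n} c i _.
Arguments cd {k n} c i.
Arguments good_graded {k n a C} g i.
Arguments good_min {k n a C} g i.
Arguments good_exact {k n a C} g i v.
Arguments cm_graded {k n a F G phi} c i.
Arguments cm_comm {k n a F G phi} c i.
Arguments gradedM {k n a r s t sr ss st M N} _ _.

(** * Uniqueness of the ranks *)

(** Dependent choice in a family of types; the invariant [P] guarantees that the next term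
    exists. *)
Lemma dep_seq (A : nat -> Type) (P : forall i, A i -> Prop)
    (R : forall i, A i -> A i.+1 -> Prop) (x0 : A 0%N) : P 0%N x0 ->
  (forall i x, P i x -> exists y, R i x y /\ P i.+1 y) ->
  exists f : forall i, A i,
    [/\ f 0%N = x0, forall i, P i (f i) & forall i, R i (f i) (f i.+1)].
Proof.
move=> P0 step.
have nxt i (x : {x | P i x}) : {y : {y | P i.+1 y} | R i (sval x) (sval y)}.
  apply: constructive_indefinite_description.
  by have [y [Ry Py]] := step i _ (proj2_sig x); exists (exist _ y Py).
pose f := fix f i : {x | P i x} := if i is j.+1 then sval (nxt j (f j)) else exist _ x0 P0.
exists (fun i => sval (f i)); split=> // i; first exact: proj2_sig.
exact: (proj2_sig (nxt i (f i))).
Qed.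

Section Uniqueness.
Variables (k : fieldType) (n : nat) (a : 'I_n -> nat).
Local Notation T := {mpoly k[n]}.

Lemma mx_lift r s t (D : 'M[T]_(t, s)) (M : 'M_(r, s)) :
  (forall i, img D (row i M)) -> exists X, M = X *m D.
Proof.
move=> /fin_all_exists[f hf]; exists (\matrix_i f i).
by apply/row_matrixP => i; rewrite row_mul rowK -hf.
Qed.

Lemma mx_lift_ker r s t u (D : 'M[T]_(t, s)) (E : 'M_(s, u)) (M : 'M_(r, s)) :
  (forall v, v *m E = 0 <-> img D v) -> M *m E = 0 -> exists X, M = X *m D.
Proof.
by move=> ex ME; apply: mx_lift => i; apply/ex; rewrite -row_mul ME row0.
Qed.

(** The modules in degree 0 have rank 1 only propositionally; [const_mx 1] stands for the identity
    between them. *)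
Lemma mul_const_row r s (v : 'rV[T]_r) (j : 'I_s) : r = 1%N ->
  exists i, (v *m const_mx 1) 0 j = v 0 i.
Proof.
by move=> e; subst r; exists 0; rewrite mxE big_ord1 mxE mulr1.
Qed.

Lemma mul_const_const r s : r = 1%N -> s = 1%N ->
  (const_mx 1 : 'M[T]_(r, s)) *m (const_mx 1 : 'M[T]_(s, r)) = 1%:M.
Proof.
move=> -> ->; apply/matrixP => i j.
by rewrite !ord1 !mxE big_ord1 !mxE mulr1.
Qed.

Variable I : T -> Prop.
Local Notation res := (minimal_graded_resolution a I).

Lemma res_dd (F : res) i : diff F i.+1 *m diff F i = 0.
Proof.
apply/row_matrixP => j; rewrite row_mul row0.
by apply/(exactS (m0 := F)); exists (delta_mx 0 j); rewrite rowE.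
Qed.

Lemma res_comparison (F G : res) :
  exists phi : forall i, 'M[T]_(Defs.rk F i, Defs.rk G i),
    phi 0%N = const_mx 1 /\ forall i, diff F i *m phi i = phi i.+1 *m diff G i.
Proof.
have [||phi [e0 _ h]] := @dep_seq (fun i => 'M[T]_(Defs.rk F i, Defs.rk G i))
  (fun i x => exists X, diff F i *m x = X *m diff G i)
  (fun i x y => diff F i *m x = y *m diff G i) (const_mx 1); last by exists phi.
- apply: mx_lift => i; apply/(exact0 (m0 := G)) => j; rewrite row_mul.
  have [c ->] := mul_const_row (row i (diff F 0)) j (rk0 F).
  by apply: (iffRL (exact0 (m0 := F) _)); exists (delta_mx 0 i); rewrite rowE.
move=> i x [X e]; exists X; split=> //.
apply: (mx_lift_ker (@exactS _ _ _ _ G i)).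
by rewrite -mulmxA -e mulmxA res_dd mul0mx.
Qed.

(** The invariant is that [diff F i] annihilates [chi i - s *m diff F i]; this is what exactness
    needs to lift the next component, and it holds at first with [s = 0]. *)
Lemma res_homotopy (F : res) (chi : forall i, 'M[T]_(Defs.rk F i, Defs.rk F i)) :
  chi 0%N = 0 -> (forall i, diff F i *m chi i = chi i.+1 *m diff F i) ->
  exists s : forall i, 'M[T]_(Defs.rk F i, Defs.rk F i.+1),
    forall i, chi i.+1 = s i.+1 *m diff F i.+1 + diff F i *m s i.
Proof.
move=> chi0 comm.
have [||s [e0 _ h]] := @dep_seq (fun i => 'M[T]_(Defs.rk F i, Defs.rk F i.+1))
  (fun i s => diff F i *m (chi i - s *m diff F i) = 0)
  (fun i s s' => chi i.+1 = s' *m diff F i.+1 + diff F i *m s) 0; last by exists s.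
- by rewrite chi0 mul0mx subr0 mulmx0.
move=> i s e.
have [|s' e'] := mx_lift_ker (M := chi i.+1 - diff F i *m s) (@exactS _ _ _ _ F i).
  by rewrite mulmxBl -comm -mulmxA -mulmxBr.
exists s'; rewrite -e' subrK opprB addrC subrK; split=> //.
by rewrite mulmxA res_dd mul0mx.
Qed.

(** Modulo the maximal ideal both homotopy terms vanish, so the identity of k^(rk F) factors through
    k^(rk G). *)
Lemma res_rank_le (F G : res) i : (Defs.rk F i.+1 <= Defs.rk G i.+1)%N.
Proof.
have [phi [phi0 hphi]] := res_comparison F G.
have [psi [psi0 hpsi]] := res_comparison G F.
have [||s hs] := @res_homotopy F (fun i => phi i *m psi i - 1%:M).
- by rewrite phi0 psi0 mul_const_const ?rk0 // subrr.
- by move=> j; rewrite mulmxBr mulmxBl mulmx1 mul1mx mulmxA hphi -mulmxA hpsi mulmxA.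
have min j : at0 (diff F j) = 0.
  by apply/matrixP => r c; rewrite !mxE diff_minimal.
apply: (@mulmx1_min _ _ _ (at0 (phi i.+1)) (at0 (psi i.+1))).
have := congr1 (@at0 _ _ _ _) (hs i).
rewrite {1}/at0 map_mxB -/(at0 _) at0M [RHS]map_mxD -!/(at0 _) !at0M !min mulmx0 mul0mx addr0.
by move/eqP; rewrite subr_eq0 => /eqP->; apply: map_mx1.
Qed.

End Uniqueness.

(** * Cones for the adjunction of a variable *)

Section Cones.
Variables (k : fieldType) (n : nat) (a : 'I_n -> nat).
Local Notation T := {mpoly k[n]}.

Section MulCone.
Variables (e : nat) (f : T) (C : cpx k n).

Definition mul_map i : 'M[T]_(crk (twist e C) i, crk C i) := f%:M.
(** One Koszul step: if [C] resolves M and [f] is regular on M, this resolves M / fM. *)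
Definition mulcone : cpx k n := cone mul_map.

Hypotheses (gC : good a C) (f_hom : supp_in (fun m => wdeg a m == e) f).
Hypotheses (f0 : f@_0%MM = 0).
Hypothesis f_reg : forall v, img (cd C 0) (f *: v) -> img (cd C 0) v.

Lemma good_mulcone : good a mulcone.
Proof.
apply: good_cone => //; first exact: good_twist.
- split=> i; first by apply: graded_scalar f_hom _.
  by rewrite /mul_map scalar_mxC.
- by move=> i; apply: at0_scalar.
by move=> v; rewrite mul_mx_scalar; apply: f_reg.
Qed.

Lemma img_mulcone v : img (cd mulcone 0) v <->
  exists w1 w2, v = f *: w1 + w2 /\ img (cd C 0) w2.
Proof.
split=> [[w /=]|[w1 [_ [-> [w ->]]]]].
  rewrite -[w]hsubmxK mul_row_col mul_mx_scalar => ->.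
  by do 2!eexists; split=> //; eexists.
by exists (row_mx w1 w); rewrite /= mul_row_col mul_mx_scalar.
Qed.

Definition mulcone_incl i : 'M[T]_(crk C i, crk mulcone i) :=
  match i with 0 => 1%:M | j.+1 => row_mx 0 1%:M end.

Lemma mulcone_incl_map : chain_map a mulcone_incl.
Proof.
split=> [[|i]|[|i]] /=.
- exact: graded1.
- apply: graded_row; first exact: graded0.
  exact: graded1.
- by rewrite mulmx1 mul_row_col mul0mx mul1mx add0r.
rewrite mul_mx_row mul_row_block !mul0mx !mul1mx !mulmx0 mulmx1 !add0r.
by [].
Qed.

End MulCone.

Lemma chain_map_comp (F G H : cpx k n) (phi : forall i, 'M[T]_(crk F i, crk G i))
    (psi : forall i, 'M[T]_(crk G i, crk H i)) :
  chain_map a phi -> chain_map a psi -> chain_map a (fun i => phi i *m psi i).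
Proof.
move=> [g1 c1] [g2 c2]; split=> i; first exact: gradedM (g1 i) (g2 i).
by rewrite mulmxA c1 -mulmxA c2 mulmxA.
Qed.

Section Step.
Variables (F K : cpx k n) (psi : forall i, 'M[T]_(crk F i, crk K i)).
Variables (theta : 'M[T]_(crk K 0, crk F 0)) (x : 'I_n).
Hypotheses (gF : good a F) (gK : good a K) (psi_map : chain_map a psi).
Hypotheses (psi_min : forall i, at0 (psi i.+1) = 0).
Hypotheses (g_theta : graded a (csh K 0) (csh F 0) theta).
Hypotheses (theta_psi : theta *m psi 0 = 1%:M) (psi_theta : psi 0 *m theta = 1%:M).
Hypothesis x_reg : forall v, img (cd F 0) ('X_x *: v) -> img (cd F 0) v.

(** With [F] resolving T/J and [K] resolving T/P', the tails resolve J and P', and this cone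
    resolves P'/J. Injectivity of J -> P' comes from the invertibility of [psi 0]. *)
Let C : cpx k n := @cone _ _ (tail F) (tail K) (fun i => psi i.+1).

Let good_C : good a C.
Proof.
have [gpsi cpsi] := psi_map.
apply: good_cone; try exact: good_tail.
- by split=> i; [apply: gpsi|apply: cpsi].
- by [].
move=> v [w /= e]; apply/(good_exact gF).
rewrite -[LHS]mulmx1 -psi_theta mulmxA -[_ *m psi 0]mulmxA cpsi mulmxA e.
by rewrite -!mulmxA (mulmxA (cd K 1)) (good_dd gK) mul0mx mulmx0.
Qed.

(** A lift of multiplication by [X_x] from P'/J to T/J. The alternating signs absorb the minus sign
    in the differential of the inner cone. *)
Definition step_map i : 'M[T]_(crk (twist (a x) C) i, crk F i) :=
  match i with
  | 0 => ('X_x)%:M *m (cd K 0 *m theta)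
  | j.+1 => col_mx ((-1) ^+ j *: ('X_x)%:M) 0
  end.

Definition stepcone : cpx k n := cone step_map.

Let X_hom : supp_in (fun m => wdeg a m == a x) ('X_x : T).
Proof. by apply: supp_inX; rewrite wdegU. Qed.

Let X0 : ('X_x : T)@_0%MM = 0.
Proof. by rewrite mcoeffX mnm1_eq0. Qed.

Let at0_signX r e : at0 ((-1) ^+ e *: ('X_x : T)%:M : 'M_r) = 0.
Proof. by rewrite /at0 map_mxZ -/(at0 _) (at0_scalar _ X0) scaler0. Qed.

Lemma good_stepcone : good a stepcone.
Proof.
have [gpsi cpsi] := psi_map.
apply: good_cone => //; first exact: good_twist.
- split=> [[|i]|[|i]] /=.
  + apply: (gradedM (ss := csh K 1)); first exact: graded_scalar X_hom _.
    exact: gradedM (good_graded gK 0) g_theta.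
  + apply: (graded_eq (sr :=
       catsh (fun j => a x + csh F i.+1 j)%N (fun j => a x + csh K i.+2 j)%N)).
      by move=> j; rewrite /catsh; case: split.
    apply: graded_col; last exact: graded0.
    by apply: gradedZ; apply: graded_scalar X_hom _.
  + rewrite mul_col_mx expr0 scale1r mul_col_mx mul0mx.
    congr col_mx; last first.
      by rewrite mulmxA scalar_mxC -mulmxA (mulmxA (cd K 1)) (good_dd gK) mul0mx mulmx0.
    rewrite mulmxA scalar_mxC -mulmxA (mulmxA (psi 1)) -cpsi -mulmxA psi_theta mulmx1.
    done.
  + rewrite mul_block_col mul_col_mx !mul0mx mulmx0 !addr0.
    rewrite -scalemxAr -scalemxAl mulNmx scalar_mxC exprS mulN1r scaleNr scalerN.
    by rewrite mulmx0 add0r.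
- case=> [|i] /=; first by rewrite !at0M (good_min gK) mul0mx mulmx0.
  by rewrite at0_col at00 at0_signX col_mx0.
(* Injectivity of P'/J -> T/J: regularity of [X_x] puts the image of [v] in J, so [v] comes from [F]
   up to a boundary of [K]. *)
move=> v /=; rewrite mulmxA mul_mx_scalar -scalemxAl => /x_reg[w2 e2].
have [|w3 e3] := iffLR (good_exact gK 0%N (v - w2 *m psi 1%N)).
  apply/eqP; rewrite mulmxBl subr_eq0 -[_ *m cd K 0]mulmx1 -theta_psi.
  by rewrite mulmxA -[_ *m cd K 0 *m _]mulmxA e2 -!mulmxA cpsi.
by exists (row_mx w2 w3); rewrite mul_row_col -e3 addrC subrK.
Qed.

Lemma img_stepcone v : img (cd stepcone 0) v <->
  exists w1 w2, [/\ v = 'X_x *: w1 + w2, img (cd K 0) (w1 *m psi 0) & img (cd F 0) w2].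
Proof.
split=> [[w /=]|[w1 [_ [-> [w ew] [w' ->]]]]].
  rewrite -[w]hsubmxK mul_row_col mulmxA mul_mx_scalar -scalemxAl => ->.
  do 2!eexists; split; first reflexivity; last by eexists.
  by exists (lsubmx w); rewrite -!mulmxA theta_psi mulmx1.
exists (row_mx w w'); rewrite /= mul_row_col mulmxA mul_mx_scalar -scalemxAl.
by rewrite mulmxA -ew -mulmxA psi_theta mulmx1.
Qed.

(** A lift of T/J' -> T/P' for J' = J + X_x P': it is [psi] on [F], a signed [X_x] on the summands
    from [K], and 0 on the shifted copy of [F]. In positive degrees its entries stay in the maximal
    ideal. *)
Definition step_psi i : 'M[T]_(crk stepcone i, crk K i) :=
  match i with
  | 0 => psi 0
  | 1 => col_mx ('X_x)%:M (psi 1)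
  | j.+2 => col_mx (col_mx 0 ((-1) ^+ j.+1 *: ('X_x)%:M)) (psi j.+2)
  end.

Lemma step_psi_min i : at0 (step_psi i.+1) = 0.
Proof.
case: i => [|i] /=; rewrite !at0_col ?at00 ?(at0_scalar _ X0) ?at0_signX psi_min ?col_mx0 //.
Qed.

Lemma step_psi_map : chain_map a step_psi.
Proof.
have [gpsi cpsi] := psi_map.
split=> [[|[|i]]|[|[|i]]] /=.
- exact: gpsi.
- by apply: graded_col => //; apply: graded_scalar X_hom _.
- apply: graded_col => //.
  apply: (graded_eq (sr :=
       catsh (fun j => a x + csh F i.+1 j)%N (fun j => a x + csh K i.+2 j)%N)).
    by move=> j; rewrite /catsh; case: split.
  apply: graded_col; first exact: graded0.
  by apply: gradedZ; apply: graded_scalar X_hom _.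
- rewrite !mul_col_mx cpsi; congr col_mx.
  by rewrite -!mulmxA theta_psi mulmx1.
- rewrite mul_block_col !mul_col_mx !mul0mx cpsi add0r expr0 scale1r expr1 scaleN1r.
  congr col_mx.
  rewrite opp_col_mx mul_col_mx add_col_mx !mulNmx addr0.
  by rewrite [psi 1 *m _]scalar_mxC addNr [cd K 1 *m _]scalar_mxC.
rewrite mul_block_col !mul_col_mx !mul0mx cpsi add0r opp_block_mx.
rewrite mul_block_col !mulmx0 !add0r !mulNmx add_col_mx addr0.
rewrite -!scalemxAl -!scalemxAr [psi i.+2 *m _]scalar_mxC [cd K i.+2 *m _]scalar_mxC.
by rewrite addNr [in RHS]exprS mulN1r scaleNr.
Qed.
End Step.
End Cones.

(** * Resolution of the monomial ideal *)

Section Tower.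
Variables (k : fieldType) (n : nat) (a : 'I_n -> nat).
Local Notation T := {mpoly k[n]}.

Lemma supp_in_mulmx (C : pred 'X_{1..n}) r s (M : 'M[T]_(r, s)) (v : 'rV_r) :
  (forall m m', C m -> C (m + m')%MM) ->
  (forall j, supp_in C (v 0 j)) -> forall j, supp_in C ((v *m M) 0 j).
Proof.
move=> hC h j; rewrite mxE; apply: supp_in_sum => i _.
by apply: (supp_inM (C2 := predT)) (h i) _ => // m1 m2 c1 _; apply: hC.
Qed.

Lemma coord_split (C : pred 'X_{1..n}) r (P Q : T -> Prop) (v : 'rV[T]_r) (f : T) :
  (forall g, supp_in C g <-> exists g1 g2, [/\ g = f * g1 + g2, P g1 & Q g2]) ->
  (forall j, supp_in C (v 0 j)) <->
  exists w1 w2, [/\ v = f *: w1 + w2, forall j, P (w1 0 j) & forall j, Q (w2 0 j)].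
Proof.
move=> hC; split=> [h|[w1 [w2 [-> h1 h2]]] j].
  have /fin_all_exists[g1 /fin_all_exists[g2 h12]] j := (iffLR (hC _) (h j)).
  exists (\row_j g1 j), (\row_j g2 j); split=> [|j|j]; rewrite ?mxE.
  - by apply/rowP => j; rewrite !mxE; case: (h12 j).
  - by case: (h12 j).
  - by case: (h12 j).
by apply: (iffRL (hC _)); exists (w1 0 j), (w2 0 j); rewrite !mxE.
Qed.

Definition unit_cpx : cpx k n :=
  @Cpx k n (fun i => if i is 0 then 1%N else 0%N) (fun _ _ => 0%N) (fun _ => 0).

Lemma good_unit_cpx : good a unit_cpx.
Proof.
split=> [i|i|i v]; first exact: graded0; first exact: at00.
by rewrite mulmx0; split=> // _; exists 0; apply/rowP => -[].
Qed.

Lemma img_unit_cpx v : img (cd unit_cpx 0) v <-> v = 0.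
Proof. by split=> [[w ->]|->]; [rewrite mulmx0|exists 0; rewrite mulmx0]. Qed.

Variables (y : 'I_n) (d N : nat).
Hypotheses (d_gt0 : (0 < d)%N) (ltdN : (d < N)%N).

Definition tot (s : seq 'I_n) (m : 'X_{1..n}) : nat := (\sum_(i <- s) m i)%N.

(* The monomials of the ideals (y^d, X_i : i in s) and
   (X_i : i in s)^2 + (X_i : i in s) y^d + (y^N). *)
Definition condP s : pred 'X_{1..n} := fun m => (d <= m y)%N || (0 < tot s m)%N.

Definition condJ s : pred 'X_{1..n} := fun m =>
  [|| (N <= m y)%N, (d <= m y)%N && (0 < tot s m)%N | (1 < tot s m)%N].

Lemma totD s m m' : tot s (m + m')%MM = (tot s m + tot s m')%N.
Proof. by rewrite /tot -big_split; apply: eq_bigr => i _; rewrite mnmDE. Qed.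

Lemma tot_cons x s m : tot (x :: s) m = (m x + tot s m)%N.
Proof. by rewrite /tot big_cons. Qed.

Lemma totU s x : x \notin s -> tot s U_(x)%MM = 0%N.
Proof.
move=> xs; rewrite /tot big_seq big1 // => i si; rewrite mnm1E.
by case: eqP => // e; rewrite e si in xs.
Qed.

Lemma condPD s m m' : condP s m -> condP s (m + m')%MM.
Proof. by rewrite /condP totD mnmDE => h; apply/orP; case/orP: h => h; [left|right]; lia. Qed.

Lemma condP_cons x s m : condP (x :: s) m = (U_(x) <= m)%MM || condP s m.
Proof. by rewrite /condP tot_cons lep1mP; lia. Qed.

Section NewVar.
Variables (x : 'I_n) (s : seq 'I_n).
Hypotheses (xy : x != y) (xs : x \notin s).

Lemma condPX m : condP s (U_(x) + m)%MM = condP s m.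
Proof. by rewrite /condP totD totU // mnmDE mnm1E (negbTE xy). Qed.

Lemma condJX m : condJ s (U_(x) + m)%MM = condJ s m.
Proof. by rewrite /condJ totD totU // mnmDE mnm1E (negbTE xy). Qed.

(** A monomial of J' outside J is divisible by [X_x]; the quotient still contains y^d or a variable
    of [x :: s], hence lies in P'. *)
Lemma condJ_split (g : T) : supp_in (condJ (x :: s)) g <->
  exists g1 g2, [/\ g = 'X_x * g1 + g2, supp_in (condP (x :: s)) g1 & supp_in (condJ s) g2].
Proof.
split=> [h|[g1 [g2 [-> h1 h2]]]].
  have [|g1 e1] := @supp_in_div _ _ U_(x)%MM (pfilt (predC (condJ s)) g).
    move=> m mm; move: (pfilt_supp mm) (pfilt_supp_in h mm) => /=.
    by rewrite lep1mP /condJ tot_cons; lia.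
  exists g1, (pfilt (condJ s) g); split; last exact: pfilt_supp.
    by rewrite -e1 addrC -pfilt_split.
  have : supp_in (predI (condJ (x :: s)) (predC (condJ s))) ('X_x * g1).
    by rewrite -e1 => m mm; rewrite /= (pfilt_supp_in h mm); apply: (pfilt_supp mm).
  move/supp_inXM; apply: supp_in_sub => m /=; rewrite condJX.
  rewrite /condJ /condP !tot_cons totD totU // !mnmDE !mnm1E eqxx (negbTE xy); lia.
apply: supp_inD; last by apply: supp_in_sub h2 => m; rewrite /condJ tot_cons; lia.
apply/supp_inXM; apply: supp_in_sub h1 => m.
rewrite /condJ /condP !tot_cons totD totU // !mnmDE !mnm1E eqxx (negbTE xy); lia.
Qed.

End NewVar.

(* [tK] resolves T/P and [tF] resolves T/J for the ideals P and J given by [condP s] and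
   [condJ s]; [tpsi] lifts the surjection T/J -> T/P.  [ttheta] inverts [tpsi 0], so that
   no identification of the rank-one modules in degree 0 is needed. *)
Record tower (s : seq 'I_n) := Tower {
  tK : cpx k n;
  tF : cpx k n;
  tpsi : forall i, 'M[T]_(crk tF i, crk tK i);
  ttheta : 'M[T]_(crk tK 0, crk tF 0);
  t_goodK : good a tK;
  t_goodF : good a tF;
  t_psi : chain_map a tpsi;
  t_psi_min : forall i, at0 (tpsi i.+1) = 0;
  t_theta : graded a (csh tK 0) (csh tF 0) ttheta;
  t_theta_psi : ttheta *m tpsi 0 = 1%:M;
  t_psi_theta : tpsi 0 *m ttheta = 1%:M;
  t_rkK : forall i, crk tK i = 'C((size s).+1, i);
  t_rkF0 : crk tF 0 = 1%N;
  t_rkF : forall i, crk tF i.+1 = (i.+1 * 'C((size s).+2, i.+2))%N;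
  t_shF0 : forall j, csh tF 0 j = 0%N;
  t_imgK : forall v, img (cd tK 0) v <-> forall j, supp_in (condP s) (v 0 j);
  t_imgF : forall v, img (cd tF 0) v <-> forall j, supp_in (condJ s) (v 0 j) }.

(** * The base case, where both ideals are generated by a power of y, and the induction *)

Lemma Xn_hom (x : 'I_n) e :
  supp_in (fun m => wdeg a m == e * a x)%N ('X_[U_(x) *+ e] : T).
Proof. by apply: supp_inX; rewrite wdegMn. Qed.

Lemma Xn_coef0 (x : 'I_n) e : (0 < e)%N -> ('X_[U_(x) *+ e] : T)@_0%MM = 0.
Proof.
move=> e0; rewrite mcoeffX; case: eqP => // /(congr1 (fun m : 'X_{1..n} => m x)).
by rewrite mulmnE mnm1E eqxx mnm0E; lia.
Qed.

Let pcone e := mulcone (e * a y)%N 'X_[U_(y) *+ e] unit_cpx.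

Let good_pcone e : (0 < e)%N -> good a (pcone e).
Proof.
move=> e0; apply: good_mulcone; [exact: good_unit_cpx|exact: Xn_hom|exact: Xn_coef0|].
move=> v /img_unit_cpx/eqP; rewrite scalemx_eq0 => /orP[|/eqP->]; last exact/img_unit_cpx.
by rewrite -msupp_eq0 msuppX.
Qed.

Let img_pcone e (C : pred 'X_{1..n}) v : (forall m, C m = (e <= m y)%N) ->
  img (cd (pcone e) 0) v <-> forall j, supp_in C (v 0 j).
Proof.
move=> hC; rewrite img_mulcone.
have hC' (m : 'X_{1..n}) : C m = (U_(y) *+ e <= m)%MM || xpred0 m.
  rewrite hC orbF; apply/idP/mnm_lepP => [h i|/(_ y)]; last first.
    by rewrite mulmnE mnm1E eqxx mul1n.
  by rewrite mulmnE mnm1E; case: eqP => [<-|]; rewrite ?mul1n.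
have spl (g : T) : supp_in C g <->
    exists g1 g2, [/\ g = 'X_[U_(y) *+ e] * g1 + g2, True & supp_in xpred0 g2].
  rewrite (supp_in_split _ hC').
  by split=> [[g1 [g2 [-> h]]]|[g1 [g2 [-> _ h]]]]; exists g1, g2.
rewrite (coord_split v spl).
split=> [[w1 [w2 [-> /img_unit_cpx->]]]|[w1 [w2 [-> _ h]]]].
  by exists w1, 0; split=> // j; rewrite mxE; apply: supp_in0.
exists w1, w2; split=> //.
by apply/img_unit_cpx/rowP => j; rewrite mxE; apply: supp_in_pred0.
Qed.

(** The comparison of the Koszul complexes of y^N and y^d; since d < N, its entry y^(N-d) lies in
    the maximal ideal. *)
Let base_psi i : 'M[T]_(crk (pcone N) i, crk (pcone d) i) :=
  (if i is 0 then 1 else 'X_[U_(y) *+ (N - d)])%:M.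

Lemma tower_nil : tower [::].
Proof.
apply: (@Tower [::] (pcone d) (pcone N) base_psi 1%:M).
- exact: good_pcone.
- by apply: good_pcone; lia.
- split=> [[|i]|[|i]] /=; first exact: graded1.
  + case: i => [|i]; last by case.
    apply: graded_scalar (@Xn_hom y (N - d)) _ => i.
    rewrite /catsh; case: split => [j|[]//]; rewrite addnA -mulnDl subnK //.
    exact: ltnW.
  + rewrite mulmx1 mul_scalar_mx scale_col_mx scaler0 /mul_map scale_scalar_mx -mpolyXD.
    congr (col_mx ('X_[_])%:M 0); apply/mnmP => i; rewrite mnmDE !mulmnE; nia.
  by rewrite [LHS]flatmx0 [RHS]flatmx0.
- case=> [|i] /=; last by rewrite [LHS]flatmx0.
  by apply: at0_scalar; apply: Xn_coef0; lia.
- exact: graded1.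
- by rewrite mulmx1.
- by rewrite mulmx1.
- by case=> [|[|i]] //=; rewrite bin_small.
- by [].
- case=> [|i] //=; rewrite bin_small ?muln0 //.
- by [].
- by move=> v; apply: img_pcone => m; rewrite /condP /tot big_nil orbF.
- by move=> v; apply: img_pcone => m; rewrite /condJ /tot big_nil andbF !orbF.
Qed.

Lemma tower_cons x s : x != y -> x \notin s -> tower s -> tower (x :: s).
Proof.
move=> xy xs [K F psi theta gK gF psi_map psi_min g_theta theta_psi psi_theta].
move=> rkK rkF0 rkF shF0 imgK imgF.
pose K' := mulcone (a x) 'X_x K.
have gK' : good a K'.
  apply: good_mulcone => //.
  - by apply: supp_inX; rewrite wdegU.
  - by rewrite mcoeffX mnm1_eq0.
  move=> v /imgK h; apply/imgK => j; move: (h j); rewrite mxE => /supp_inXM.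
  by apply: supp_in_sub => m; rewrite condPX.
have imgK' v : img (cd K' 0) v <-> forall j, supp_in (condP (x :: s)) (v 0 j).
  rewrite img_mulcone.
  have spl (g : T) : supp_in (condP (x :: s)) g <->
      exists g1 g2, [/\ g = 'X_x * g1 + g2, True & supp_in (condP s) g2].
    rewrite (supp_in_split _ (condP_cons x s)).
    by split=> [[g1 [g2 [-> h]]]|[g1 [g2 [-> _ h]]]]; exists g1, g2.
  rewrite (coord_split v spl).
  by split=> [[w1 [w2 [-> /imgK h]]]|[w1 [w2 [-> _ h]]]]; exists w1, w2; split=> //; apply/imgK.
pose psi' i := psi i *m mulcone_incl (a x) 'X_x K i.
have psi'_map : chain_map a psi' by apply: chain_map_comp (mulcone_incl_map _ _ _ _).
have psi'_min i : at0 (psi' i.+1) = 0 by rewrite at0M psi_min mul0mx.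
have psi'0 : psi' 0%N = psi 0%N by rewrite /psi' /= mulmx1.
have x_reg v : img (cd F 0) ('X_x *: v) -> img (cd F 0) v.
  move=> /imgF h; apply/imgF => j; move: (h j); rewrite mxE => /supp_inXM.
  by apply: supp_in_sub => m; rewrite condJX.
have theta_psi' : theta *m psi' 0%N = 1%:M by rewrite psi'0.
have psi'_theta : psi' 0%N *m theta = 1%:M by rewrite psi'0.
apply: (@Tower (x :: s) K' (stepcone a psi' theta x) (step_psi a psi' theta x) theta) => //.
- exact: good_stepcone.
- exact: step_psi_map.
- exact: step_psi_min.
- case=> [|i] /=; first by rewrite rkK !bin0.
  by rewrite !rkK [in RHS]binS addnC.
- case=> [|i] /=.
    by rewrite rkF !rkK bin0 bin1 !mul1n [RHS]binS bin1; lia.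
  (* The ranks of F_(i+1), K'_(i+2) and F_(i+2) add up: (i+1) A + A + (i+2) B = (i+2) (A + B), where
     A and B are the binomials of size s + 2 over i + 2 and i + 3. *)
  rewrite !rkF !rkK [in RHS]binS.
  have := binS (size s).+1 i.+1; move: 'C(_, _) 'C(_, _) 'C(_, _) 'C(_, _) => A B C D; nia.
move=> v; rewrite img_stepcone // (coord_split v (condJ_split xy xs)).
split=> [[w1 [w2 [-> h1 h2]]]|[w1 [w2 [-> h1 h2]]]]; exists w1, w2; split=> //.
- rewrite -[w1]mulmx1 -psi'_theta mulmxA; apply: supp_in_mulmx; first exact: condPD.
  exact/imgK'.
- exact/imgF.
- by apply/imgK'; apply: supp_in_mulmx; first exact: condPD.
exact/imgF.
Qed.

Lemma tower_exists s : uniq s -> y \notin s -> tower s.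
Proof.
elim: s => [|x s IH] /=; first by move=> *; apply: tower_nil.
move=> /andP[xs us]; rewrite inE negb_or eq_sym => /andP[xy ys].
exact: tower_cons xy xs (IH us ys).
Qed.

End Tower.

(** * Lifting a resolution along a regular variable *)

Section Lifting.
Variables (k : fieldType) (n : nat) (a : 'I_n -> nat) (x : 'I_n).
Local Notation T := {mpoly k[n]}.
Hypothesis ax_gt0 : (0 < a x)%N.

Lemma hfiltD r P (sh : 'I_r -> nat) (v w : 'rV[T]_r) :
  hfilt a P sh (v + w) = hfilt a P sh v + hfilt a P sh w.
Proof. by apply/rowP => c; rewrite !mxE pfiltD. Qed.

Lemma hfiltX r (P : pred nat) (sh : 'I_r -> nat) (v : 'rV[T]_r) :
  hfilt a P sh ('X_x *: v) = 'X_x *: hfilt a (fun e => P (a x + e)%N) sh v.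
Proof.
apply/rowP => c; rewrite !mxE; apply: pfiltXM => m.
by rewrite wdegD wdegU addnA.
Qed.

Definition bounded r (sh : 'I_r -> nat) B (v : 'rV[T]_r) :=
  forall c, supp_in (fun m => wdeg a m + sh c < B)%N (v 0 c).

Lemma bounded_exists r (sh : 'I_r -> nat) (v : 'rV[T]_r) : exists B, bounded sh B v.
Proof.
exists (\max_c \max_(m <- msupp (v 0%R c)) (wdeg a m + sh c).+1)%N => c m mv.
apply: leq_trans (leq_bigmax c).
exact: (@leq_bigmax_seq _ _ xpredT (fun m => (wdeg a m + sh c).+1)).
Qed.

Lemma hfilt_id r (P : pred nat) (sh : 'I_r -> nat) (v : 'rV[T]_r) :
  (forall c, supp_in (fun m => P (wdeg a m + sh c)%N) (v 0 c)) -> hfilt a P sh v = v.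
Proof. by move=> h; apply/rowP => c; rewrite mxE pfilt_id. Qed.

(* [ZI] and [ZJ] are submodules of a graded free module which agree modulo [X_x], a
   variable regular modulo both. *)
Record liftable r (sh : 'I_r -> nat) (ZI ZJ : 'rV[T]_r -> Prop) : Prop := Liftable {
  lift0 : ZI 0;
  liftB : forall v w, ZI v -> ZI w -> ZI (v - w);
  liftZ : forall f v, ZI v -> ZI (f *: v);
  lift_filt : forall P v, ZI v -> ZI (hfilt a P sh v);
  lift_regI : forall v, ZI ('X_x *: v) -> ZI v;
  lift_regJ : forall v, ZJ ('X_x *: v) -> ZJ v;
  lift_IJ : forall v, ZI v -> exists z, ZJ (v + 'X_x *: z);
  lift_JI : forall v, ZJ v -> exists z, ZI (v + 'X_x *: z) }.

Lemma scaleX_inj r (v : 'rV[T]_r) : 'X_x *: v = 0 -> v = 0.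
Proof.
move/eqP; rewrite scalemx_eq0 => /orP[|/eqP//].
by rewrite -msupp_eq0 msuppX.
Qed.

(** Graded Nakayama: generators of [ZJ], corrected by multiples of [X_x] so as to lie in [ZI],
    generate [ZI]. The two syzygy modules are again liftable, so the step can be iterated. *)
Lemma lift_step r s (sr : 'I_s -> nat) (sh : 'I_r -> nat) ZI ZJ (DJ : 'M[T]_(s, r)) :
  liftable sh ZI ZJ -> graded a sr sh DJ -> (forall v, ZJ v <-> img DJ v) ->
  exists DI : 'M[T]_(s, r),
    [/\ graded a sr sh DI, at0 DI = at0 DJ, forall v, ZI v <-> img DI v &
        liftable sr (fun v => v *m DI = 0) (fun v => v *m DJ = 0)].
Proof.
move=> [I0 IB IZ If Ir Jr IJ JI] gDJ imJ.
have ID v w : ZI v -> ZI w -> ZI (v + w).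
  by move=> Iv Iw; rewrite -[w]opprK -[- w]sub0r; apply: (IB) => //; apply: IB.
(* The corrected row is made homogeneous by projection to degree [sr i], under which [ZI] is
   stable. *)
have /fin_all_exists[z hz] (i : 'I_s) : exists z : 'rV[T]_r, ZI (row i DJ + 'X_x *: z) /\
    hfilt a (pred1 (sr i)) sh (row i DJ + 'X_x *: z) = row i DJ + 'X_x *: z.
  have [|z Iz] := JI (row i DJ); first by apply/imJ; exists (delta_mx 0 i); rewrite rowE.
  have e : hfilt a (pred1 (sr i)) sh (row i DJ) = row i DJ.
    by apply: hfilt_id => c; rewrite mxE; apply: gDJ.
  have e2 := If (pred1 (sr i)) _ Iz; rewrite hfiltD e hfiltX in e2.
  eexists; split; first exact: e2.
  rewrite hfiltD e hfiltX; congr (_ + _ *: _).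
  by apply/rowP => c; apply/mpolyP => m; rewrite !mxE !mcoeff_pfilt; case: ifP => // ->.
pose Z := \matrix_i z i; pose DI := DJ + 'X_x *: Z.
have rowDI i : row i DI = row i DJ + 'X_x *: z i.
  by apply/rowP => c; rewrite !mxE.
have gDI : graded a sr sh DI.
  move=> i c; have [_ ez] := hz i.
  have -> : DI i c = row i DI 0 c by rewrite [RHS]mxE.
  by rewrite rowDI -ez mxE; apply: pfilt_supp.
have imI v : ZI v <-> img DI v.
  split=> [Iv|[w ->]]; last first.
    rewrite mulmx_sum_row; elim/big_rec: _ => // i u _ Iu.
    by apply: ID => //; apply: IZ; rewrite rowDI; case: (hz i).
  (* Each division by [X_x] lowers the degree, so the approximation modulo [X_x] stops. *)
  have [B] := bounded_exists sh v; elim: B v Iv => [|B IH] v Iv bv.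
    exists 0; rewrite mul0mx; apply/rowP => c; rewrite mxE.
    by apply: supp_in_pred0; apply: supp_in_sub (bv c).
  have [z0 /imJ[w ew]] := IJ v Iv.
  (* Truncation below degree B + 1 leaves [v] unchanged and, as [a x] is positive, bounds [z1] by
     B. *)
  pose P := fun e => (e < B.+1)%N.
  pose z1 := hfilt a (fun e => P (a x + e)%N) sh (- z0 - w *m Z).
  have ev : v = hfilt a P sr w *m DI + 'X_x *: z1.
    rewrite -{1}(hfilt_id (P := P) (sh := sh) bv) /z1 -(hfilt_mul P w gDI) -hfiltX -hfiltD.
    congr (hfilt a P sh _); rewrite /DI mulmxDr -ew -scalemxAr scalerBr scalerN.
    by rewrite -opprD -[v + _ + _]addrA addrK.
  have Iw : ZI (hfilt a P sr w *m DI).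
    rewrite mulmx_sum_row; elim/big_rec: _ => // i u _ Iu.
    by apply: ID => //; apply: IZ; rewrite rowDI; case: (hz i).
  have Iz1 : ZI z1.
    by apply: Ir; have := IB _ _ Iv Iw; rewrite ev addrC addKr.
  have [|w1 ew1] := IH z1 Iz1.
    move=> c; rewrite mxE; apply: supp_in_sub (@pfilt_supp _ _ _ _) => m.
    by rewrite /P; lia.
  by exists (hfilt a P sr w + 'X_x *: w1); rewrite {1}ev ew1 mulmxDl scalemxAl.
exists DI; split=> //.
  apply/matrixP => i j; rewrite !mxE mcoeffD -[X in _ + X]/(mcoeff 0%MM _).
  by rewrite rmorphM /= mcoeffX mnm1_eq0 mul0r addr0.
split.
- by rewrite mul0mx.
- by move=> v w e1 e2; rewrite mulmxBl e1 e2 subrr.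
- by move=> f v e; rewrite -scalemxAl e scaler0.
- move=> P v e; rewrite -(hfilt_mul P v gDI) e.
  by apply/rowP => c; rewrite !mxE pfilt0.
- by move=> v; rewrite -scalemxAl => /scaleX_inj.
- by move=> v; rewrite -scalemxAl => /scaleX_inj.
(* From v DI = 0 follows X_x (v Z) = - v DJ, so v Z is in [ZJ] by regularity. If v Z = w DJ, then v
   + X_x w is a syzygy of [DJ]. The converse direction is similar. *)
- move=> v; rewrite mulmxDr -scalemxAr => e.
  have [|w ew] := iffLR (imJ (v *m Z)).
    apply: Jr; apply/imJ; exists (- v); rewrite mulNmx; apply/eqP.
    by rewrite -addr_eq0 addrC e.
  by exists w; rewrite mulmxDl -scalemxAl -ew.
move=> v e; have [|w ew] := iffLR (imI (v *m Z)).
  by apply: Ir; apply/imI; exists v; rewrite mulmxDr e add0r scalemxAr.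
by exists (- w); rewrite mulmxDl -scalemxAl mulNmx -ew mulmxDr e add0r -scalemxAr scalerN subrr.
Qed.

Lemma lift_complex (C : cpx k n) ZI ZJ : good a C ->
  liftable (csh C 0) ZI ZJ -> (forall v, ZJ v <-> img (cd C 0) v) ->
  exists D : forall i, 'M[T]_(crk C i.+1, crk C i),
    good a (Cpx (csh C) D) /\ forall v, ZI v <-> img (D 0%N) v.
Proof.
move=> gC lC imC.
have [D0 [gD0 mD0 imD0 lD0]] := lift_step lC (good_graded gC 0) imC.
have [||D [eD hD RD]] := @dep_seq (fun i => 'M[T]_(crk C i.+1, crk C i))
  (fun i D => [/\ graded a (csh C i.+1) (csh C i) D, at0 D = 0 &
     liftable (csh C i.+1) (fun v => v *m D = 0) (fun v => v *m cd C i = 0)])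
  (fun i D D' => forall v, v *m D = 0 <-> img D' v) D0.
- by rewrite (good_min gC) in mD0.
- move=> i D [_ _ lD].
  have [D' [gD' mD' imD' lD']] := lift_step lD (good_graded gC i.+1) (good_exact gC i).
  by exists D'; split=> //; rewrite (good_min gC) in mD'.
exists D; split; last by rewrite eD.
by split=> i /=; [case: (hD i)|case: (hD i)|apply: RD].
Qed.

End Lifting.

(** * The ideal of a semigroup and its initial ideal *)

Section SemigroupIdeal.
Variables (k : fieldType) (n : nat) (a : 'I_n -> nat).
Local Notation T := {mpoly k[n]}.
Local Notation ev := (mmap (@polyC k) (fun i : 'I_n => 'X^(a i))).
Local Notation I := (semigroup_ideal k a).

Lemma mmap1_wdeg (m : 'X_{1..n}) :
  mmap1 (fun i : 'I_n => 'X^(a i) : {poly k}) m = 'X^(wdeg a m).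
Proof.
rewrite /mmap1 /wdeg -prodrXr; apply: eq_bigr => i _.
by rewrite -exprM mulnC.
Qed.

Lemma ev_X (m : 'X_{1..n}) : ev ('X_[m] : T) = 'X^(wdeg a m).
Proof. by rewrite mmapX mmap1_wdeg. Qed.

Lemma coef_ev (f : T) s : (ev f)`_s = \sum_(m <- msupp f | wdeg a m == s) f@_m.
Proof.
rewrite /mmap coef_sum [RHS]big_mkcond; apply: eq_bigr => m _.
by rewrite mmap1_wdeg coefCM coefXn eq_sym; case: ifP; rewrite ?mulr1 ?mulr0.
Qed.

Lemma coef_ev_eq0 (f : T) s : supp_in (fun m => wdeg a m != s) f -> (ev f)`_s = 0.
Proof.
by move=> h; rewrite coef_ev big_seq_cond big1 // => m /andP[/h/negbTE->].
Qed.

Lemma evD (f g : T) : ev (f + g) = ev f + ev g.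
Proof. exact: raddfD. Qed.

Lemma evB (f g : T) : ev (f - g) = ev f - ev g.
Proof. exact: raddfB. Qed.

Lemma evM (f g : T) : ev (f * g) = ev f * ev g.
Proof. exact: rmorphM. Qed.

Lemma idealB f g : I f -> I g -> I (f - g).
Proof. by rewrite /semigroup_ideal evB => -> ->; rewrite subrr. Qed.

Lemma idealM f g : I g -> I (f * g).
Proof. by rewrite /semigroup_ideal evM => ->; rewrite mulr0. Qed.

Lemma ideal0 : I 0.
Proof. by rewrite /semigroup_ideal raddf0. Qed.

Lemma ideal_reg x f : I ('X_x * f) -> I f.
Proof.
rewrite /semigroup_ideal evM => /eqP; rewrite mulf_eq0 => /orP[|/eqP//].
by rewrite ev_X expf_eq0 polyX_eq0 andbF.
Qed.

(** Evaluation sends a monomial of degree s to t^s, so its kernel is homogeneous. *)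
Lemma ideal_filt (P : pred nat) f : I f -> I (pfilt (fun m => P (wdeg a m)) f).
Proof.
move=> If; apply/polyP => s; rewrite coef0.
have := congr1 (fun g : {poly k} => g`_s) If.
rewrite coef0 {1}(pfilt_split (fun m => P (wdeg a m)) f) evD coefD.
case Ps: (P s); last first.
  move=> _; apply: coef_ev_eq0 => m /pfilt_supp.
  by apply: contraTneq => ->; rewrite Ps.
rewrite [X in _ + X = _]coef_ev_eq0 ?addr0 // => m /pfilt_supp /=.
by apply: contraNneq => ->.
Qed.

Lemma ideal_binomial (m1 m2 : 'X_{1..n}) : wdeg a m1 = wdeg a m2 -> I ('X_[m1] - 'X_[m2]).
Proof. by move=> e; rewrite /semigroup_ideal evB !ev_X e subrr. Qed.

(* [C] is the initial ideal of [I] at [X_x = 0]; the monomials outside [C] not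
   divisible by [X_x] represent the Apery set of the semigroup at [a x]. *)
Variables (C : pred 'X_{1..n}) (x : 'I_n).
Hypotheses (CX : forall m, C (U_(x) + m)%MM = C m).
Hypotheses (C_red : forall m, C m -> exists m', wdeg a m = wdeg a (U_(x) + m')%MM).
Hypotheses (apery : forall m m', ~~ C m -> m x = 0%N ->
  wdeg a (U_(x) + m')%MM != wdeg a m).
Hypotheses (apery_inj : forall m m', ~~ C m -> m x = 0%N -> ~~ C m' -> m' x = 0%N ->
  wdeg a m = wdeg a m' -> m = m').

(** Each monomial of [f] is completed to a binomial of the ideal by the multiple of [X_x] that
    [C_red] provides. *)
Lemma initial_to_ideal f : supp_in C f -> exists g, I (f + 'X_x * g).
Proof.
move=> hf.
suff gen l : {subset l <= msupp f} ->
    exists g, I (\sum_(m <- l) f@_m *: 'X_[m] + 'X_x * g).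
  by have := gen _ (fun m mf => mf); rewrite -mpolyE.
elim: l => [|m l IH] sub.
  by exists 0; rewrite big_nil mulr0 addr0; apply: ideal0.
have [|g Ig] := IH; first by move=> m' m'l; apply: sub; rewrite inE m'l orbT.
have [m' em] := C_red (hf _ (sub _ (mem_head _ _))).
exists (g - f@_m *: 'X_[m']); rewrite big_cons mulrBr -scalerAr -mpolyXD.
rewrite [X in I X](_ : _ = (\sum_(j <- l) f@_j *: 'X_[j] + 'X_x * g)
   - ((f@_m)%:MP * ('X_[U_(x) + m'] - 'X_[m]))).
  by apply: idealB => //; apply: idealM; apply: ideal_binomial.
by rewrite mul_mpolyC scalerBr opprB [_ *: _ + _]addrC -!addrA; congr (_ + _); rewrite addrCA.
Qed.

(** Once the part of [f] in [C] is lifted and subtracted, there remains, modulo [X_x], a combination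
    [s] of monomials outside [C] free of [X_x]. Their degrees are distinct and differ from those of
    all multiples of [X_x], so [s = 0]. *)
Lemma ideal_to_initial f : I f -> exists g, supp_in C (f + 'X_x * g).
Proof.
move=> If; have [g1 Ig1] := initial_to_ideal (@pfilt_supp _ _ C f).
pose r := pfilt (predC C) f.
have [g2 eg2] : exists g2, pfilt (fun m => U_(x) <= m)%MM r = 'X_x * g2.
  by apply: supp_in_div; apply: pfilt_supp.
pose s := pfilt (predC (fun m => U_(x) <= m)%MM) r.
have hs : supp_in (fun m => ~~ C m && (m x == 0%N)) s.
  move=> m mm; move: (pfilt_supp mm); rewrite /= lep1mP negbK => ->; rewrite andbT.
  exact: (pfilt_supp_in (@pfilt_supp _ _ _ _) mm).
have er : r = 'X_x * g2 + s by rewrite -eg2 -pfilt_split.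
have Is : I ('X_x * (g2 - g1) + s).
  have := idealB If Ig1; rewrite {1}(pfilt_split C f) -/r er.
  by rewrite opprD addrACA subrr add0r mulrBr addrAC.
have s0 : s = 0.
  apply/mpolyP => m; rewrite mcoeff0; apply/eqP; apply: contraT.
  rewrite mcoeff_eq0 negbK => ms; move: (hs _ ms) => /andP[Cm /eqP mx].
  have := congr1 (fun g : {poly k} => g`_(wdeg a m)) Is.
  rewrite coef0 evD coefD coef_ev_eq0 ?add0r; last first.
    by apply/supp_inXM => m' _; apply: apery.
  rewrite coef_ev big_seq_cond (eq_bigl (fun m' => (m' \in msupp s) && (m' == m))).
    rewrite -big_seq_cond big_mkcond (bigD1_seq m) ?msupp_uniq //= eqxx.
    rewrite big1 ?addr0; last by move=> m' /negbTE->.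
    by move/eqP; rewrite mcoeff_eq0 ms.
  move=> m'; case ms': (m' \in msupp s) => //=; apply/eqP/eqP => [e|->//].
  by move: (hs _ ms') => /andP[Cm' /eqP mx']; apply: apery_inj.
exists (- g2); rewrite (pfilt_split C f) -/r er s0 addr0 mulrN addrK.
exact: pfilt_supp.
Qed.

Lemma liftable_initial r (sh : 'I_r -> nat) :
  liftable a x sh (fun v => forall j, I (v 0 j)) (fun v => forall j, supp_in C (v 0 j)).
Proof.
split.
- by move=> j; rewrite mxE; apply: ideal0.
- by move=> v w h1 h2 j; rewrite !mxE; apply: idealB.
- by move=> f v h j; rewrite mxE; apply: idealM.
- by move=> P v h j; rewrite mxE; apply: (ideal_filt (fun e => P (e + sh j)%N)).
- by move=> v h j; apply: (@ideal_reg x); move: (h j); rewrite mxE.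
- move=> v h j; have := h j; rewrite mxE => /supp_inXM.
  by apply: supp_in_sub => m; rewrite CX.
- move=> v h; have /fin_all_exists[g hg] j := ideal_to_initial (h j).
  by exists (\row_j g j) => j; rewrite !mxE.
move=> v h; have /fin_all_exists[g hg] j := initial_to_ideal (h j).
by exists (\row_j g j) => j; rewrite !mxE.
Qed.

End SemigroupIdeal.

(** * Kunz-Waldi semigroups *)

Lemma tot_gt0 n (s : seq 'I_n) (m : 'X_{1..n}) : (0 < tot s m)%N ->
  exists i m', i \in s /\ m = (U_(i) + m')%MM.
Proof.
rewrite /tot lt0n sum_nat_seq_neq0 => /hasP[i si mi].
by exists i, (m - U_(i))%MM; split=> //; rewrite addmC submK // lep1mP.
Qed.

Lemma tot_eq0 n (s : seq 'I_n) (m : 'X_{1..n}) i : tot s m = 0%N -> i \in s -> m i = 0%N.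
Proof. by move/eqP; rewrite sum_nat_seq_eq0 => /allP h /h/eqP. Qed.

Lemma tot_addU n (s : seq 'I_n) (m : 'X_{1..n}) i : uniq s -> i \in s ->
  tot s (U_(i) + m)%MM = (tot s m).+1.
Proof.
move=> us si; rewrite totD {1}/tot (bigD1_seq i) //= mnm1E eqxx big1 // => j.
by rewrite mnm1E eq_sym => /negbTE->.
Qed.

Section KunzWaldi.
Local Open Scope nat_scope.
Variables (p q m d : nat) (x h : nat -> nat).
Hypotheses (p_ge3 : 3 <= p) (lt_pq : p < q) (co_pq : coprime p q) (m_gt0 : 0 < m).
Hypothesis h_def : forall j, 1 <= j <= m -> h j + x j * p + (m.+1 - j) * d * q = p * q.
Hypotheses (x_gt0 : 0 < x 1) (x_incr : forall i, 1 <= i -> i.+1 <= m -> x i < x i.+1).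
Hypotheses (x_le : 2 * x m <= q) (d_gt0 : 0 < d) (d_le : 2 * (m * d) <= p).
Hypothesis not_ci : m = 1 -> 2 * x 1 <> q /\ 2 * d <> p.

Let N := p - m * d.
Let a : 'I_m.+2 -> nat := KW_generators p q m.+2 h.
Let u : 'I_m.+2 := ord0.
Let v : 'I_m.+2 := Ordinal (isT : 1 < m.+2).
Let w (j : 'I_m) : 'I_m.+2 := rshift 2 j.
Let s : seq 'I_m.+2 := map w (enum 'I_m).

Lemma ord_cases (P : 'I_m.+2 -> Prop) : P u -> P v -> (forall j, P (w j)) -> forall i, P i.
Proof.
move=> Pu Pv Pw [[|[|i]] li].
- by rewrite (_ : Ordinal li = u) //; apply: val_inj.
- by rewrite (_ : Ordinal li = v) //; apply: val_inj.
by rewrite (_ : Ordinal li = w (Ordinal (li : i < m))) //; apply: val_inj.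
Qed.

Lemma uniq_s : uniq s.
Proof. by rewrite map_inj_uniq ?enum_uniq // => i j /(congr1 val) [] /val_inj. Qed.

Lemma size_s : size s = m.
Proof. by rewrite size_map size_enum_ord. Qed.

Lemma mem_s i : i \in s -> exists j, i = w j.
Proof. by move=> /mapP[j _ ->]; exists j. Qed.

Lemma w_mem_s j : w j \in s.
Proof. by apply: map_f; rewrite mem_enum. Qed.

Lemma v_notin_s : v \notin s.
Proof. by apply/negP => /mem_s[j /(congr1 val)]. Qed.

Lemma u_notin_s : u \notin s.
Proof. by apply/negP => /mem_s[j /(congr1 val)]. Qed.

(** * Inequalities between the parameters *)

Lemma x_mono i j : 1 <= i -> i <= j -> j <= m -> x i <= x j.
Proof.
move=> i1; elim: j => [|j IH] ij jm; first by have -> : i = 0 by lia.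
case: (ltngtP i j.+1) => [lij||->//]; last by lia.
have := IH ltac:(lia) ltac:(lia); have := x_incr (i := j); lia.
Qed.

Lemma x_mono_lt i j : 1 <= i -> i < j -> j <= m -> x i < x j.
Proof.
move=> i1 ij jm; have := x_mono (i := i.+1) (j := j) isT ij jm.
have := x_incr (i := i); lia.
Qed.

Lemma md_le_N : m * d <= N.
Proof. rewrite /N; lia. Qed.

(** If m > 1, then N >= m d >= 2 d. If m = 1, then N = p - d with 2 d <= p, and [not_ci] excludes
    equality. *)
Lemma d_lt_N : d < N.
Proof.
rewrite /N; case: (ltngtP m 1) => [|lt1m|m1]; first by lia.
  have : 2 * d <= m * d by rewrite leq_mul2r lt1m orbT.
  lia.
move: (not_ci m1) d_le; rewrite m1; lia.
Qed.

Lemma N_le_p : N <= p. Proof. by rewrite /N; lia. Qed.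

(* For the degree [t] of a monomial in J: some binomial of the ideal has leading monomial
   of degree [t] and trailing monomial divisible by u. *)
Definition reducible t := exists m', t = wdeg a (U_(u) + m')%MM.

Lemma reducible_add t m' : reducible t -> reducible (t + wdeg a m').
Proof. by move=> [m1 ->]; exists (m1 + m')%MM; rewrite addmA [RHS]wdegD. Qed.

Lemma wdeg_w j : a (w j) = h j.+1. Proof. by []. Qed.

(** The binomial is v^N - u^(x_1) u_1, as N q = h_1 + x_1 p. One factor u is built into [reducible],
    whence the predecessor here and below. *)
Lemma reducible_vN : reducible (N * q).
Proof.
exists (U_(w (Ordinal m_gt0)) + U_(u) *+ (x 1).-1)%MM.
rewrite !wdegD wdegMn !wdegU wdeg_w /= /a /=.
have := h_def (j := 1) ltac:(lia); rewrite /N subSS subn0 mulnBl.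
by rewrite /KW_generators /=; nia.
Qed.

(** With indices from 1: h_j + d q = h_(j+1) + (x_(j+1) - x_j) p for j < m, and h_m + d q = (q -
    x_m) p. *)
Lemma reducible_wv (j : 'I_m) : reducible (h j.+1 + d * q).
Proof.
have lj := ltn_ord j.
have := h_def (j := j.+1) ltac:(lia).
case: (ltnP j.+1 m) => [ljm|mj] ej.
  have := h_def (j := j.+2) ltac:(lia).
  have := x_incr (i := j.+1) isT ljm.
  exists (U_(w (Ordinal ljm)) + U_(u) *+ (x j.+2 - x j.+1).-1)%MM.
  rewrite !wdegD wdegMn !wdegU wdeg_w /= {1 2}/a /KW_generators /=.
  nia.
exists (U_(u) *+ (q - x m).-1)%MM.
have e : j.+1 = m by lia.
rewrite !wdegD wdegMn !wdegU /= {1 2}/a /KW_generators /=.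
rewrite e in ej *; rewrite subSn // subnn in ej; nia.
Qed.

(** With indices from 1 and y_i = (m + 1 - i) d: h_i + h_j = (q - x_i - x_j) p + (p - y_i - y_j) q,
    where the coefficient of p is positive unless x_i = x_j = q/2. *)
Lemma reducible_ww (i j : 'I_m) : reducible (h i.+1 + h j.+1).
Proof.
have li := ltn_ord i; have lj := ltn_ord j.
have ei := h_def (j := i.+1) ltac:(lia); have ej := h_def (j := j.+1) ltac:(lia).
rewrite !subSS in ei ej.
have xi := x_mono (i := i.+1) (j := m) isT ltac:(lia) ltac:(lia).
have xj := x_mono (i := j.+1) (j := m) isT ltac:(lia) ltac:(lia).
have yi : (m - i) * d <= m * d by rewrite leq_mul2r leq_subr orbT.
have yj : (m - j) * d <= m * d by rewrite leq_mul2r leq_subr orbT.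
case: (ltnP (x i.+1 + x j.+1) q) => [lt|ge].
  exists (U_(u) *+ (q - (x i.+1 + x j.+1)).-1 + U_(v) *+ (p - ((m - i) * d + (m - j) * d)))%MM.
  rewrite !wdegD !wdegMn !wdegU /= /a /KW_generators /=.
  rewrite addnA -mulSn prednK ?subn_gt0 //.
  move: ((m - i) * d) ((m - j) * d) ei ej yi yj => A B ei ej yi yj.
  have : (x i.+1 + x j.+1) * p <= q * p by rewrite leq_mul2r ltnW ?orbT.
  have : (A + B) * q <= p * q by rewrite leq_mul2r; apply/orP; right; lia.
  rewrite !mulnBl !mulnDl; lia.
(* Now q = 2 x_m and i = j: u_m^2 - v^(p - 2d) lies in the ideal, and N <= p - 2d. *)
have im : i.+1 = m.
  case: (ltngtP i.+1 m) li => // lt _; have := x_mono_lt (i := i.+1) isT lt (leqnn m); lia.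
have jm : j.+1 = m.
  case: (ltngtP j.+1 m) lj => // lt _; have := x_mono_lt (i := j.+1) isT lt (leqnn m); lia.
have m2 : 2 <= m.
  case: (ltngtP m 1) => [|//|m1]; first by lia.
  by move: (not_ci m1) ge x_le; rewrite im jm m1; lia.
have -> : h i.+1 + h j.+1 = N * q + wdeg a (U_(v) *+ ((m - 2) * d)).
  rewrite wdegMn {1}/a /KW_generators /= im jm in ei *.
  have e1 : m - i = 1 by lia.
  rewrite e1 mul1n in ei.
  have q2 : q = 2 * x m by move: ge; rewrite im jm; lia.
  rewrite -mulnDl; have -> : N + (m - 2) * d = p - 2 * d by rewrite /N mulnBl; nia.
  rewrite mulnBl; nia.
exact: reducible_add reducible_vN.
Qed.

Lemma reducible_condJ mm : condJ v d N s mm -> reducible (wdeg a mm).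
Proof.
have vpow e (m' : 'X_{1..m.+2}) : e <= m' v -> m' = (U_(v) *+ e + (m' - U_(v) *+ e))%MM.
  move=> le; rewrite addmC submK //; apply/mnm_lepP => i.
  by rewrite mulmnE mnm1E; case: eqP => [<-|]; rewrite ?mul1n.
case/or3P => [/vpow->|/andP[dv /tot_gt0[i [m' [/mem_s[j ->] em]]]]|].
- rewrite wdegD; apply: reducible_add; rewrite wdegMn; exact: reducible_vN.
- have dv' : d <= m' v.
    by move: dv; rewrite em mnmDE mnm1E; case: eqP => [/(congr1 val)|].
  rewrite em (vpow _ _ dv') addmA wdegD; apply: reducible_add.
  rewrite wdegD wdegMn !wdegU; exact: reducible_wv.
move=> tot1; have /tot_gt0[i [m1 [si e1]]] : 0 < tot s mm by lia.
move: tot1; rewrite e1 (tot_addU _ uniq_s si) ltnS => /tot_gt0[i2 [m2 [si2 ->]]].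
have [j ->] := mem_s si; have [j2 ->] := mem_s si2.
rewrite addmA wdegD; apply: reducible_add; rewrite wdegD !wdegU; exact: reducible_ww.
Qed.

(* [r * q - ashift r * p] is the Apery element congruent to [r * q] modulo [p]. *)
Definition ashift r := if r < N then 0 else x ((r - N) %/ d).+1.

Lemma block_le r : r < p -> N <= r -> (r - N) %/ d < m.
Proof. by move=> rp Nr; rewrite ltn_divLR // /N; move: Nr; rewrite /N; lia. Qed.

Lemma ashift_mono r r' : r <= r' -> r' < p -> ashift r <= ashift r'.
Proof.
move=> rr' r'p; rewrite /ashift; case: (ltnP r N) => // Nr.
have Nr' := leq_trans Nr rr'; rewrite ltnNge Nr' /=.
apply: x_mono => //; last exact: block_le.
by rewrite ltnS leq_div2r // leq_sub2r.
Qed.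

Lemma ashift_le r : r < p -> 2 * ashift r <= q.
Proof.
move=> rp; rewrite /ashift; case: ltnP => // Nr.
have := x_mono (i := ((r - N) %/ d).+1) (j := m) isT (block_le rp Nr) (leqnn m); lia.
Qed.

(** The indices from N to p - 1 form m blocks of length d. Block j, counted from 0, belongs to the
    monomials u_(j+1) v^b with b < d, as h_(j+1) = (p - (m - j) d) q - x_(j+1) p. *)
Lemma ashift_block (j : 'I_m) b : b < d -> ashift (p - (m - j) * d + b) = x j.+1.
Proof.
move=> bd; have lj := ltn_ord j.
have e : p - (m - j) * d = N + j * d.
  by rewrite /N mulnBl; have : j * d <= m * d by [rewrite leq_mul2r ltnW ?orbT]; lia.
rewrite /ashift e ltnNge -addnA leq_addr /= addKn divnMDl //.
by rewrite divn_small // addn0.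
Qed.

(** [t] is the Apery candidate of its class plus a multiple of p, written without subtraction. *)
Definition has_nf t := exists r c, r < p /\ t + ashift r * p = r * q + c * p.

Lemma has_nf_p t : has_nf t -> has_nf (t + p).
Proof. by move=> [r [c [rp e]]]; exists r, c.+1; split=> //; rewrite mulSn; lia. Qed.

Lemma ashift0 : ashift 0 = 0.
Proof. by rewrite /ashift ifT //; have := d_lt_N; lia. Qed.

(** If r + r' reaches p, then p copies of q are traded for q copies of p; the last hypothesis keeps
    the coefficient of p nonnegative in both cases. *)
Lemma has_nf_add r c r' c' t t' : r < p -> r' < p ->
  t + ashift r * p = r * q + c * p -> t' + ashift r' * p = r' * q + c' * p ->
  ashift r + ashift r' <= (if r + r' < p then ashift (r + r') else q) -> has_nf (t + t').
Proof.
move=> rp r'p e e'; case: ifP => [lt|ge] le.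
  exists (r + r'), (c + c' + (ashift (r + r') - (ashift r + ashift r'))); split=> //.
  have -> : ashift (r + r') = ashift r + ashift r' + (ashift (r + r') - (ashift r + ashift r')) by lia.
  move: (ashift (r + r') - (ashift r + ashift r')) => D; nia.
exists (r + r' - p), (c + c' + ashift (r + r' - p) + (q - (ashift r + ashift r'))); split; first by lia.
have eq : q = (ashift r + ashift r') + (q - (ashift r + ashift r')) by lia.
have er : r + r' = p + (r + r' - p) by lia.
move: (r + r' - p) (q - (ashift r + ashift r')) eq er => R D eq er.
have : (r + r') * q = (p + R) * q by rewrite er.
nia.
Qed.

Lemma has_nf_q t : has_nf t -> has_nf (t + q).
Proof.
move=> [r [c [rp e]]]; have dN := d_lt_N.
have shift1 : ashift 1 = 0 by rewrite /ashift ifT //; lia.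
apply: (@has_nf_add r c 1 0) => //; [by lia|by rewrite shift1; lia|].
rewrite shift1 addn0; case: ifP => lt; first by apply: ashift_mono => //; lia.
by have := ashift_le rp; lia.
Qed.

Lemma has_nf_h t (j : 'I_m) : has_nf t -> has_nf (t + h j.+1).
Proof.
move=> [r [c [rp e]]]; have lj := ltn_ord j.
have ej := h_def (j := j.+1) ltac:(lia); rewrite subSS in ej.
have shiftj : ashift (p - (m - j) * d) = x j.+1 by rewrite -(ashift_block j d_gt0) addn0.
have y0 : 0 < (m - j) * d by rewrite muln_gt0 d_gt0 subn_gt0 lj.
have yj : (m - j) * d <= m * d by rewrite leq_mul2r leq_subr orbT.
have r'p : p - (m - j) * d < p by lia.
apply: (@has_nf_add r c (p - (m - j) * d) 0) => //.
  by rewrite shiftj mulnBl; nia.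
(* After a wrap both shifts are at most q/2. Otherwise r < (m - j) d <= N, so [ashift r] is 0 and
   monotonicity suffices. *)
case: ifP => lt; last by have := ashift_le rp; have := ashift_le r'p; lia.
have -> : ashift r = 0 by rewrite /ashift ifT //; have := md_le_N; lia.
by apply: ashift_mono => //; lia.
Qed.

Lemma has_nf_wdeg mm : has_nf (wdeg a mm).
Proof.
rewrite /wdeg; elim/big_rec: _ => [|i t _ nft].
  by exists 0, 0; rewrite ashift0; split=> //; lia.
elim: (mm i) => [|e IH]; first by rewrite mul0n.
rewrite mulSn -addnA addnC; move: i IH; apply: ord_cases => [||j] IH.
- exact: has_nf_p.
- exact: has_nf_q.
exact: has_nf_h.
Qed.

(* The monomial outside J, not divisible by u, whose degree is congruent to [r * q]. *)
Definition std_mon r : 'X_{1..m.+2} :=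
  if r < N then (U_(v) *+ r)%MM
  else (U_(insubd u ((r - N) %/ d).+2) + U_(v) *+ ((r - N) %% d))%MM.

(** Such a monomial is v^r with r < N, or u_(j+1) v^b with b < d, and then r = N + j d + b. *)
Lemma std_nf mm : ~~ condJ v d N s mm -> mm u = 0 ->
  exists r, [/\ r < p, wdeg a mm + ashift r * p = r * q & mm = std_mon r].
Proof.
have pure (m' : 'X_{1..m.+2}) : m' u = 0 -> tot s m' = 0 -> m' = (U_(v) *+ m' v)%MM.
  move=> mu t0; apply/mnmP; apply: ord_cases => [||j]; rewrite mulmnE mnm1E.
  - by rewrite mu.
  - by rewrite eqxx mul1n.
  by rewrite (tot_eq0 t0 (w_mem_s j)).
rewrite /condJ !negb_or -!ltnNge => /and3P[vN dt t1] mu.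
have [t0|t0] := posnP (tot s mm).
  exists (mm v); rewrite /ashift /std_mon vN mul0n addn0; split; last exact: pure.
    by apply: leq_trans vN N_le_p.
  by rewrite {1}(pure _ mu t0) wdegMn.
have [i [m' [si em]]] := tot_gt0 t0; have [j ej] := mem_s si.
have t0' : tot s m' = 0 by move: t1; rewrite em (tot_addU _ uniq_s si); lia.
have mu' : m' u = 0 by move: mu; rewrite em mnmDE; lia.
have ev : mm v = m' v by rewrite em mnmDE mnm1E ej.
have vd : m' v < d by move: dt; rewrite ev t0 andbT -ltnNge.
have lj := ltn_ord j.
have hj := h_def (j := j.+1) ltac:(lia); rewrite subSS in hj.
have yj : (m - j) * d <= m * d by rewrite leq_mul2r leq_subr orbT.
have yd : d <= (m - j) * d by rewrite leq_pmull // subn_gt0.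
exists (p - (m - j) * d + m' v); split.
- by lia.
- rewrite ashift_block // em ej (pure _ mu' t0') wdegD wdegMn wdegU wdeg_w /=.
  rewrite mulmnE mnm1E eqxx mul1n /a /KW_generators /= mulnDl mulnBl; nia.
have e : p - (m - j) * d + m' v = N + (j * d + m' v).
  by rewrite /N mulnBl; have : j * d <= m * d by [rewrite leq_mul2r ltnW ?orbT]; lia.
rewrite e /std_mon ltnNge leq_addr /= addKn divnMDl // divn_small // addn0.
rewrite modnMDl modn_small // {1}em -(pure _ mu' t0') ej; congr (U_(_) + _)%MM.
(* The index is in range, so the default [u] of [insubd] does not occur. *)
by apply: val_inj; rewrite val_insubd /= !ltnS lj.
Qed.

Lemma residue_inj r r' A B : r < p -> r' < p -> r * q + A * p = r' * q + B * p -> r = r'.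
Proof.
wlog le : r r' A B / r <= r'.
  move=> wl rp r'p e; case: (leqP r r') => [|/ltnW] le; first exact: (wl _ _ A B).
  by symmetry; apply: (wl _ _ B A).
move=> rp r'p e.
have : p %| (r' - r) * q.
  by rewrite mulnBl -(addnK (B * p) (r' * q)) -e subnAC addKn -mulnBl dvdn_mull.
rewrite Gauss_dvdl // => dv; apply/eqP; rewrite eqn_leq le /= -subn_eq0.
case: posnP => // pos; have := dvdn_leq pos dv; lia.
Qed.

(** Equal degrees would force the same index r. But the degree of [m'] is at least the Apery
    candidate of its class, and the factor u adds p to it. *)
Lemma apery_min mm m' : ~~ condJ v d N s mm -> mm u = 0 ->
  wdeg a (U_(u) + m')%MM != wdeg a mm.
Proof.
move=> /std_nf h1 /h1[r [rp e _]]; have [r' [c [r'p e']]] := has_nf_wdeg m'.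
apply/eqP; rewrite wdegD wdegU (_ : a u = p) // => e2.
have er : r' = r by apply: (@residue_inj _ _ (c.+1 + ashift r) (ashift r')) => //; nia.
rewrite er in e'; nia.
Qed.

Lemma apery_inj mm m' : ~~ condJ v d N s mm -> mm u = 0 ->
  ~~ condJ v d N s m' -> m' u = 0 -> wdeg a mm = wdeg a m' -> mm = m'.
Proof.
move=> /std_nf h1 /h1[r [rp e em]] /std_nf h2 /h2[r' [r'p e' em']] e2.
rewrite em em'; congr std_mon; apply: (@residue_inj _ _ (ashift r') (ashift r)) => //; lia.
Qed.

Lemma KW_resolution (k : fieldType) :
  exists F : minimal_graded_resolution a (semigroup_ideal k a),
    forall i, Defs.rk F i.+1 = i.+1 * 'C(m.+2, i.+2).
Proof.
have [K F psi theta _ gF _ _ _ _ _ _ rF0 rF shF0 _ imF] :=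
  @tower_exists k _ a v d N d_gt0 d_lt_N s uniq_s v_notin_s.
have lF : liftable a u (csh F 0) (fun w => forall j, semigroup_ideal k a (w 0%R j))
    (fun w => forall j, supp_in (condJ v d N s) (w 0%R j)).
  apply: liftable_initial.
  - by move=> mm; apply: condJX => //; apply: u_notin_s.
  - exact: reducible_condJ.
  - exact: apery_min.
  - exact: apery_inj.
have ap : 0 < a u by rewrite /a /KW_generators /=; lia.
have [|D [gD imD]] := lift_complex ap gF lF; first by move=> w0; rewrite imF.
have gr i r c mm : mm \in msupp (D i r c) -> wdeg a mm + csh F i c = csh F i.+1 r.
  by move=> /(good_graded gD i r c)/eqP.
have mi i r c : ((D i r c)@_0%MM = 0)%R.
  by have := congr1 (fun M : 'M_(_, _) => M r c) (good_min gD i); rewrite !mxE.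
exists (MinimalGradedResolution rF0 shF0 imD (good_exact gD) gr mi) => i.
by rewrite /= rF size_s.
Qed.

End KunzWaldi.

Theorem corollary2p8 (k : fieldType) (p q n : nat) (x y h : nat -> nat)
  (d : nat) :
  (3 <= p)%N -> (p < q)%N -> coprime p q ->
  KW_data p q n x y h ->
  embedding_dimension (generated (KW_generators p q n h)) n ->
  (2 * ((n - 2) * d) <= p)%N ->
  (forall i, (1 <= i <= n - 2)%N -> y i = ((n - i - 1) * d)%N) ->
  (n = 3 -> 2 * x 1%N <> q /\ 2 * y 1%N <> p)%N ->
  forall i, (1 <= i <= n - 1)%N ->
    betti_number (k := k) (KW_generators p q n h)
      (semigroup_ideal k (KW_generators p q n h)) i (i * 'C(n, i.+1))%N.
Proof.
move=> p3 pq co [n3 hdef [x0 xinc xq] [_ _ ym]] _ dp ydef n3ci.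
have [m en] : exists m, n = m.+2 by exists (n - 2)%N; lia.
subst n; rewrite subn2 /= in n3 hdef x0 xinc xq ym dp ydef n3ci *.
have m0 : (0 < m)%N by lia.
have ydef' i : (1 <= i <= m)%N -> y i = ((m.+1 - i) * d)%N.
  by move=> hi; rewrite ydef //; congr (_ * _)%N; lia.
have [|||F hF] := @KW_resolution p q m d x h p3 pq co m0 _ x0 xinc xq _ dp _ k.
- by move=> j hj; rewrite -ydef' // hdef.
- by move: ym; rewrite (ydef' m) ?m0 ?leqnn // (_ : m.+1 - m = 1)%N ?mul1n //; lia.
- by move=> m1; move: n3ci ydef'; rewrite m1 => /(_ erefl) h1 h2; rewrite h2 ?mul1n in h1.
case=> // i _; split; first by exists F.
(* Any other resolution is compared with the constructed one in both directions. *)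
by move=> G; rewrite -hF; apply/eqP; rewrite eqn_leq !res_rank_le.
Qed.
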